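(* For each $n\ge1$ let $\nu_n$ be a probability distribution on $\{0,\dots,n-1\}$, and let $(G_n)_{n\ge1}$ be the growing sequence of random graphs constructed from $(\nu_n)_{n\ge 1}$ (as defined in the context). Let $D_n\sim\nu_n$, and suppose that $D_n/n$ converges in distribution to $\nu$ as $n\to\infty$, for some (Borel) probability measure $\nu$ on $[0,1]$. Let $\Gamma_\nu$ be the graph limit defined by the kernel $W:([0,1]^2)^2\to[0,1]$, $$W\bigl((s_1,t_1),(s_2,t_2)\bigr)=\begin{cases}s_2,& t_1<t_2,\\ s_1,& t_1>t_2,\\ 0,& t_1=t_2,\end{cases}$$ on the probability space $([0,1]^2,\mu_\nu)$, where $\mu_\nu=\nu\times\lambda$ and $\lambda$ is Lebesgue measure on $[0,1]$. Then $G_n\to\Gamma_\nu$ in probability as $n\to\infty$.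
   Context: All graphs are simple and undirected, and finite unless said otherwise. The random graphs $G_n$: given probability distributions $\nu_n$ on $\{0,\dots,n-1\}$ for $n\ge1$, the random graphs $G_1,G_2,\dots$ are constructed as a Markov process as follows. (i) $G_1=K_1$ is the graph with the single vertex $1$. (ii) For $n\ge2$, let $D_n$ be a random variable with distribution $\nu_n$, and construct $G_n$ by adding a new vertex $n$ to $G_{n-1}$ and connecting it to $D_n$ of the previously existing vertices $1,\dots,n-1$; given $D_n$, these vertices are chosen uniformly at random among all $\binom{n-1}{D_n}$ possibilities. Here $D_n$ and the choice of vertices are (jointly) independent of $G_{n-1}$ and of the earlier steps of the construction. Thus $G_n$ has vertex set $\{1,\dots,n\}$. Graph limits: for finite graphs $F,G$, let $t(F,G)$ be the probability that a uniformly random map $\varphi:V(F)\to V(G)$ is a graph homomorphism, i.e. $\varphi(i)$ and $\varphi(j)$ are adjacent in $G$ whenever $i$ and $j$ are adjacent in $F$. A kernel on a probability space $(S,\mu)$ is a symmetric measurable function $W:S^2\to[0,1]$. It defines a graph limit $\Gamma_W$, which is determined by the numbers $$t(F,\Gamma_W)=\int_{S^{V(F)}}\prod_{\{i,j\}\in E(F)}W(x_i,x_j)\prod_{i\in V(F)}d\mu(x_i)$$ for all finite graphs $F$. The set of all (unlabelled) graphs together with all graph limits is a compact metric space, in which a sequence of graphs $H_n$ with $|V(H_n)|\to\infty$ converges to a graph limit $\Gamma$ if and only if $t(F,H_n)\to t(F,\Gamma)$ for every finite graph $F$. For random graphs $G_n$ with $|V(G_n)|=n$, ''$G_n\to\Gamma$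 in probability'' means convergence in probability in this metric space; equivalently, for every finite graph $F$, $t(F,G_n)\to t(F,\Gamma)$ in probability. *)

(* Defs.v *)
From HB Require Import structures.
From mathcomp Require Import all_boot all_order all_algebra.
From mathcomp Require Import all_classical all_reals all_analysis.

Set Implicit Arguments.
Unset Strict Implicit.
Unset Printing Implicit Defensive.

Import Order.TTheory GRing.Theory Num.Theory.
Import numFieldNormedType.Exports.

Local Open Scope classical_set_scope.
Local Open Scope ring_scope.

(* The edge set is stored as a symmetric irreflexive set of ordered pairs. *)
Definition is_sgraph n (E : {set 'I_n * 'I_n}) : bool :=
  [forall i, (i, i) \notin E] &&
  [forall i, forall j, ((i, j) \in E) == ((j, i) \in E)].

Record sgraph n := SGraph {
  sgraph_edges : {set 'I_n * 'I_n};
  _ : is_sgraph sgraph_edges }.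

HB.instance Definition _ n := [isSub for @sgraph_edges n].
HB.instance Definition _ n := [Finite of sgraph n by <:].

Definition adj n (G : sgraph n) : rel 'I_n :=
  fun i j => (i, j) \in sgraph_edges G.

(* Every finite graph is isomorphic to an element of this countable type. *)
Definition finite_graph := {n : nat & sgraph n}.

Lemma empty_sgraph_subproof n : is_sgraph (finset.set0 : {set 'I_n * 'I_n}).
Proof.
by apply/andP; split; do ?[apply/forallP => ?]; rewrite ?finset.inE.
Qed.

Definition empty_sgraph n : sgraph n := SGraph (empty_sgraph_subproof n).

(* [add_vertex G A] adds to G the new vertex [ord_max] with neighbourhood A;
   the old vertex i becomes [lift ord_max i], which has the same value. *)
Definition add_vertex_adj n (G : sgraph n) (A : {set 'I_n}) : rel 'I_n.+1 :=
  fun i j => match unlift ord_max i, unlift ord_max j with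
             | Some i', Some j' => adj G i' j'
             | Some i', None => i' \in A
             | None, Some j' => j' \in A
             | None, None => false
             end.

Lemma add_vertex_subproof n (G : sgraph n) (A : {set 'I_n}) :
  is_sgraph [set p | add_vertex_adj G A p.1 p.2]%SET.
Proof.
case: G => E H; have /andP[/forallP irr /forallP sym] := H.
apply/andP; split; apply/forallP => i; last (apply/forallP => j);
  rewrite !finset.inE /add_vertex_adj /adj /=.
  by case: unlift.
case: (unlift ord_max i) => [i'|]; case: (unlift ord_max j) => [j'|] //=.
by have /forallP := sym i'; apply.
Qed.

Definition add_vertex n (G : sgraph n) (A : {set 'I_n}) : sgraph n.+1 :=
  SGraph (add_vertex_subproof G A).

(* The vertices 1, ..., n are represented by the ordinals 0, ..., n-1, and
   [N n] is the neighbourhood that vertex n chooses among 1, ..., n-1.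
   [growth N 1] is the one-vertex graph, as [N 1] is a subset of ['I_0]. *)
Fixpoint growth (N : forall n, {set 'I_n.-1}) (n : nat) : sgraph n :=
  match n with
  | 0 => empty_sgraph 0
  | m.+1 => add_vertex (growth N m) (N m.+1)
  end.

(* Independence of X and Y for the discrete sigma-algebras on U and V; meant
   for random variables that take countably many values. *)
Definition indep_discrete d (T : measurableType d) (R : realType)
    (P : probability T R) (U V : Type) (X : T -> U) (Y : T -> V) : Prop :=
  forall (A : set U) (B : set V),
    P (X @^-1` A `&` Y @^-1` B) = (P (X @^-1` A) * P (Y @^-1` B))%E.

(* The random choices (D_j, N_j) of the steps j = 2, ..., n - 1. *)
Definition earlier_steps (T : Type) (D : nat -> T -> nat)
    (N : forall n, T -> {set 'I_n.-1}) (n : nat) (w : T) :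
    forall i : 'I_n.-2, nat * {set 'I_i.+1} :=
  fun i => (D i.+2 w, N i.+2 w).
Arguments earlier_steps {T} D N n w.

(* In step n the degree D_n has law nu_n and, given D_n, the set N_n of
   neighbours is uniform among the subsets of size D_n of the n-1 existing
   vertices; (D_n, N_n) is independent of the earlier steps, and hence of
   G_(n-1), which is a function of them. *)
Record growing_steps d (T : measurableType d) (R : realType)
    (P : probability T R) (nu_ : nat -> probability nat R)
    (D : nat -> T -> nat) (N : forall n, T -> {set 'I_n.-1}) : Prop := {
  steps_measurable : forall n, (1 < n)%N -> forall k (A : {set 'I_n.-1}),
    measurable [set w | D n w = k /\ N n w = A];
  steps_degree : forall n, (1 < n)%N -> forall B : set nat,
    P (D n @^-1` B) = nu_ n B;
  steps_uniform : forall n, (1 < n)%N -> forall k (A : {set 'I_n.-1}),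
    P [set w | D n w = k /\ N n w = A] =
    (P [set w | D n w = k] *
     (if #|A| == k then ('C(n.-1, k)%:R)^-1 else 0)%:E)%E;
  steps_indep : forall n, (1 < n)%N ->
    indep_discrete P (fun w => (D n w, N n w)) (earlier_steps D N n) }.

Section degree_ratio.
Context {R : realType} (n : nat).

Definition degree_ratio (k : nat) : R := k%:R / n%:R.

Let measurable_degree_ratio : measurable_fun setT degree_ratio.
Proof. by []. Qed.

HB.instance Definition _ :=
  isMeasurableFun.Build _ _ _ _ degree_ratio measurable_degree_ratio.

End degree_ratio.
Arguments degree_ratio : clear implicits.

Definition cvg_in_distribution (R : realType)
    (mu_ : nat -> probability R R) (mu : probability R R) : Prop :=
  forall f : R -> R, continuous f -> (exists M : R, forall x, `|f x| <= M) ->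
    (\int[mu_ n]_x (f x)%:E)%E @[n --> \oo] --> (\int[mu]_x (f x)%:E)%E.

Definition cvg_in_probability d (T : measurableType d) (R : realType)
    (P : probability T R) (S : pseudoMetricType R) (X : nat -> T -> S) (l : S)
    : Prop :=
  forall e : R, 0 < e ->
    P [set w | ~ ball l e (X n w)] @[n --> \oo] --> 0%E.

Section cons_tuple.
Context {d} {S : measurableType d} (k : nat).

Definition cons_pair (p : S * k.-tuple S) : k.+1.-tuple S :=
  [tuple of p.1 :: p.2].

Let measurable_cons_pair : measurable_fun setT cons_pair.
Proof. exact: measurable_cons measurable_fst measurable_snd. Qed.

HB.instance Definition _ :=
  isMeasurableFun.Build _ _ _ _ cons_pair measurable_cons_pair.

End cons_tuple.
Arguments cons_pair {d S} k.

Fixpoint prob_power d (S : measurableType d) (R : realType)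
    (mu : probability S R) (k : nat) : probability (k.-tuple S) R :=
  match k with
  | 0 => \d_([tuple] : 0.-tuple S)
  | m.+1 => distribution (mu \x prob_power mu m)%E (cons_pair m)
  end.

(* This is t(F, G). *)
Definition hom_density (R : realType) k n (F : sgraph k) (G : sgraph n) : R :=
  #|[set phi : {ffun 'I_k -> 'I_n} |
      [forall i, forall j, adj F i j ==> adj G (phi i) (phi j)]]%SET|%:R
  / #|{ffun 'I_k -> 'I_n}|%:R.

(* This is t(F, Gamma_W); each edge {i, j} of F is counted once, as i < j. *)
Definition kernel_density d (S : measurableType d) (R : realType)
    (mu : probability S R) (W : S -> S -> R) k (F : sgraph k) : R :=
  \int[prob_power mu k]_x
    \prod_(i < k) \prod_(j < k | (i < j)%N && adj F i j)
      W (tnth x i) (tnth x j).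

(* Graphs and graph limits are points of the product of countably many copies
   of R: the coordinate [Some F] is t(F, -), and the coordinate [None] is
   1/|V(G)| for a graph G and 0 for a graph limit.  The space of unlabelled
   graphs and graph limits is a compact subspace of this product, metrized
   by the library's [ball] on countable products, which induces the product
   topology. *)
Notation graph_space R := {ptws option finite_graph -> R}.

Definition graph_point (R : realType) n (G : sgraph n) : graph_space R :=
  fun o => if o is Some F then hom_density R (tagged F) G else n%:R^-1.

Definition graph_limit d (S : measurableType d) (R : realType)
    (mu : probability S R) (W : S -> S -> R) : graph_space R :=
  fun o => if o is Some F then kernel_density mu W (tagged F) else 0.

(* The unit square is represented by the probability measure
   nu x lambda on R * R, which is concentrated on it when nu is
   concentrated on [0, 1].  [uniform_prob ltr01] is lambda on [0, 1]; the
   library defines it on [measurableTypeR R], i.e. R with its Borel sets. *)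
Definition mu_nu (R : realType) (nu : probability R R) :
    probability (R * measurableTypeR R)%type R :=
  (nu \x uniform_prob (@ltr01 R))%E.

Definition W_nu (R : realType) (x y : R * R) : R :=
  if x.2 < y.2 then y.1 else if y.2 < x.2 then x.1 else 0.

Definition Gamma_nu (R : realType) (nu : probability R R) : graph_space R :=
  graph_limit (mu_nu nu) (@W_nu R).

(* Main.v *)
Require Import Defs.
From mathcomp Require Import all_boot all_order all_algebra.
From mathcomp Require Import all_classical all_reals all_analysis.
From mathcomp Require Import measurable_realfun.
From mathcomp Require Import ring lra zify.

Import Order.TTheory GRing.Theory Num.Theory.
Import numFieldNormedType.Exports.

Set Implicit Arguments.
Unset Strict Implicit.
Unset Printing Implicit Defensive.

Local Open Scope classical_set_scope.
Local Open Scope ring_scope.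

(** A ball around the limit constrains finitely many homomorphism densities
    only ([ptws_ball_coordinates]), so it suffices that the density of each
    fixed graph [F] on ['I_k] in the growing graph tends in probability to its
    density in the limit.  This is a second moment argument.

    The density of [F] is the average, over all maps [phi] from ['I_k] to
    ['I_n], of the indicator that [phi] is a homomorphism.  This indicator
    depends only on what the vertices in the image of [phi] choose when they
    arrive: each has to choose those images of its neighbours in [F] that are
    older than itself ([is_hom_growth]).  Different vertices choose
    independently ([prob_neighbourhoods]), so that for an injective [phi]

      P (phi is a homomorphism) = \prod_v attach (phi v) (older_degree phi v),

    where [attach m c] is the probability that vertex [m] chooses [c] given
    older vertices, and [older_degree phi v] counts the neighbours of [v] with
    an older image.  For the same reason the indicators of two maps with
    disjoint images are independent; all but a fraction k^2 / n of the pairs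
    of maps are of this kind, so the variance of the density is O(1 / n).

    It remains to find the limit of the mean.  A vertex [m] of degree D chooses
    [c] given vertices with a probability close to (D / m)^c, so [attach m c]
    tends to the moment of order [c] of [nu] ([cvg_attach]).  By Cesaro's
    theorem, replacing each factor by its limit changes the average over [phi]
    by o(1).  The average of products of moments obtained in this way is, up to
    the fraction O(1 / n) of maps that are not injective, exactly the density
    of [F] in the limit ([kernel_density_avg]): cut the time axis [0, 1) into
    [n] cells and split the integral according to the map that sends each
    vertex of [F] to the cell of its time.  If the vertices lie in different
    cells, then the order of the times is that of the cells, each edge
    contributes the mark of its younger end, and the integral factors into
    moments of [nu]. *)

(** * Averages over finite types *)

Definition avg (R : numFieldType) (I : finType) (f : I -> R) : R :=
  (\sum_i f i) / #|I|%:R.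

Section Averages.
Context {R : numFieldType}.
Implicit Types I J : finType.

Lemma eq_avg I (f g : I -> R) : f =1 g -> avg f = avg g.
Proof. by move=> fg; rewrite /avg (eq_bigr _ (fun i _ => fg i)). Qed.

Lemma avgD I (f g : I -> R) : avg (fun i => f i + g i) = avg f + avg g.
Proof. by rewrite /avg big_split mulrDl. Qed.

Lemma avgN I (f : I -> R) : avg (fun i => - f i) = - avg f.
Proof. by rewrite /avg sumrN mulNr. Qed.

Lemma avgZ I (c : R) (f : I -> R) : avg (fun i => c * f i) = c * avg f.
Proof. by rewrite /avg -mulr_sumr mulrA. Qed.

Lemma avg_sum I (J : Type) (r : seq J) (Q : pred J) (f : J -> I -> R) :
  avg (fun i => \sum_(j <- r | Q j) f j i) = \sum_(j <- r | Q j) avg (f j).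
Proof. by rewrite /avg exchange_big mulr_suml. Qed.

Lemma avg_const I (c : R) : (0 < #|I|)%N -> avg (fun _ : I => c) = c.
Proof.
move=> I0; rewrite /avg sumr_const -[c *+ _]mulr_natr mulfK//.
by rewrite pnatr_eq0 -lt0n.
Qed.

Lemma ler_avg I (f g : I -> R) : (forall i, f i <= g i) -> avg f <= avg g.
Proof.
by move=> fg; rewrite ler_wpM2r ?invr_ge0 ?ler0n// ler_sum.
Qed.

Lemma ler_norm_avg I (f : I -> R) : `|avg f| <= avg (fun i => `|f i|).
Proof.
rewrite normrM normfV [`|_%:R|]ger0_norm ?ler0n//.
by rewrite ler_wpM2r ?invr_ge0 ?ler0n// ler_norm_sum.
Qed.

(** The coordinates of a uniformly random function are independent. *)
Lemma avg_prod I J (f : I -> J -> R) :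
  avg (fun phi : {ffun I -> J} => \prod_i f i (phi i)) = \prod_i avg (f i).
Proof.
rewrite /avg -bigA_distr_bigA card_ffun natrX -exprVn.
by rewrite big_split /= prodr_const.
Qed.

Lemma avg_coord I J (i : I) (f : J -> R) : (0 < #|J|)%N ->
  avg (fun phi : {ffun I -> J} => f (phi i)) = avg f.
Proof.
move=> J0.
have := avg_prod (fun l (a : J) => if l == i then f a else 1).
rewrite [in RHS](bigD1 i)//= big1 => [|l /negbTE ->]; last exact: avg_const.
rewrite mulr1 (eq_avg (g := f)) => [<-|a]; last by rewrite eqxx.
apply: eq_avg => phi; rewrite (bigD1 i)//= eqxx big1 ?mulr1//.
by move=> l /negbTE ->.
Qed.

Lemma avg_eq1 J (a : J) : avg (fun b : J => (b == a)%:R : R) = #|J|%:R^-1.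
Proof.
rewrite /avg (bigD1 a)//= eqxx big1 => [|b /negbTE ->//].
by rewrite addr0 mul1r.
Qed.

Lemma avg_collision I J (i i' : I) : (0 < #|J|)%N -> i != i' ->
  avg (fun phi : {ffun I -> J} => (phi i == phi i')%:R : R) = #|J|%:R^-1.
Proof.
move=> J0 ii'.
pose f (a : J) l (b : J) : R :=
  if (l == i) || (l == i') then (b == a)%:R else 1.
(* Split by the common value [a]: then the coordinates are independent. *)
rewrite (eq_avg (g := fun phi : {ffun I -> J} =>
  \sum_a \prod_l f a l (phi l))); last first.
  move=> phi; rewrite (bigD1 (phi i))//= [X in _ + X]big1 ?addr0.
    rewrite (bigD1 i)//= /f !eqxx mul1r (bigD1 i')/= 1?eq_sym//.
    rewrite eqxx orbT big1 ?mulr1 1?eq_sym//.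
    by move=> l /andP[/negbTE-> /negbTE->].
  move=> a aE; rewrite (bigD1 i)//= /f eqxx /=.
  by rewrite [_ == a]eq_sym (negbTE aE) mul0r.
rewrite avg_sum.
under eq_bigr => a _.
  rewrite avg_prod (bigD1 i)//= (bigD1 i')/= 1?eq_sym//.
  rewrite big1; last first.
    move=> l /andP[/negbTE li /negbTE li'].
    by rewrite /f li li' avg_const.
  rewrite mulr1 /f !eqxx orbT /= !avg_eq1.
  over.
rewrite sumr_const -[_ *+ _]mulr_natl mulVKf//.
by rewrite pnatr_eq0 -lt0n.
Qed.

(** Union bound over the pairs of indices that may collide. *)
Lemma avg_not_injective k n : (0 < n)%N ->
  avg (fun phi : {ffun 'I_k -> 'I_n} => (~~ injectiveb phi)%:R : R)
  <= (k ^ 2)%:R / n%:R.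
Proof.
move=> n0.
pose coll (phi : {ffun 'I_k -> 'I_n}) : R :=
  \sum_i \sum_(j | i != j) (phi i == phi j)%:R.
apply: (@le_trans _ _ (avg coll)).
  apply: ler_avg => phi; case: injectiveP => [_|]; rewrite /=.
    by apply: sumr_ge0 => i _; apply: sumr_ge0.
  move=> /injectiveP/injectivePn[i [j ij e]].
  rewrite /coll (bigD1 i)//= (bigD1 j)//= e eqxx -addrA lerDl.
  by apply: addr_ge0; apply: sumr_ge0 => // l _; apply: sumr_ge0.
rewrite avg_sum.
apply: (@le_trans _ _ (\sum_(i < k) \sum_(j < k) n%:R^-1)).
  apply: ler_sum => i _; rewrite avg_sum [leRHS](bigID (fun j => i != j))/=.
  rewrite -[leLHS]addr0 lerD// ?sumr_ge0//.
  by apply: ler_sum => j ij; rewrite avg_collision ?card_ord.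
by rewrite !sumr_const card_ord -mulrnA -[leLHS]mulr_natl mulnn.
Qed.

(** Union bound: each of the [k ^ 2] events [phi i = psi j] has frequency
    [1 / n]. *)
Lemma avg_overlap k n : (0 < n)%N ->
  avg (fun phi : {ffun 'I_k -> 'I_n} => avg (fun psi : {ffun 'I_k -> 'I_n} =>
    [exists i, exists j, phi i == psi j]%:R : R)) <= (k ^ 2)%:R / n%:R.
Proof.
move=> n0.
have c0 : (0 < #|{ffun 'I_k -> 'I_n}|)%N.
  by rewrite card_ffun !card_ord expn_gt0 n0.
rewrite -[leRHS](avg_const _ c0); apply: ler_avg => phi.
apply: (@le_trans _ _
  (avg (fun psi : {ffun 'I_k -> 'I_n} => \sum_i \sum_j (psi j == phi i)%:R))).
  apply: ler_avg => psi; case: existsP => [[i /existsP[j /eqP e]]|_] /=.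
    rewrite (bigD1 i)//= (bigD1 j)//= e eqxx -addrA lerDl.
    by apply: addr_ge0; apply: sumr_ge0 => // l _; apply: sumr_ge0.
  by apply: sumr_ge0 => i _; apply: sumr_ge0.
rewrite avg_sum.
under eq_bigr => i _.
  rewrite avg_sum.
  under eq_bigr => j _.
    rewrite (avg_coord j (fun b => (b == phi i)%:R : R)) ?card_ord//.
    rewrite avg_eq1 card_ord.
  over.
  over.
by rewrite !sumr_const card_ord -mulrnA -[leLHS]mulr_natl mulnn.
Qed.

(** Changing one factor at a time costs at most the change of that factor, as
    the others lie in [0, 1]. *)
Lemma ler_dist_prod I (Q : pred I) (x y : I -> R) :
  (forall i, 0 <= x i <= 1) -> (forall i, 0 <= y i <= 1) ->
  `|\prod_(i | Q i) x i - \prod_(i | Q i) y i| <= \sum_(i | Q i) `|x i - y i|.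
Proof.
move=> x01 y01.
pose K (a b s : R) := [/\ 0 <= a <= 1, 0 <= b <= 1 & `|a - b| <= s].
suff [] : K (\prod_(i | Q i) x i) (\prod_(i | Q i) y i)
            (\sum_(i | Q i) `|x i - y i|) by [].
elim/big_rec3: _ => [|i s b a Qi [a01 b01 abs]].
  by split; rewrite ?subrr ?normr0 ?ler01 ?lexx.
have /andP[x0 x1] := x01 i; have /andP[y0 y1] := y01 i.
have /andP[a0 a1] := a01; have /andP[b0 b1] := b01.
split; rewrite ?mulr_ge0 ?mulr_ile1//.
have -> : x i * a - y i * b = (x i - y i) * a + y i * (a - b) by ring.
rewrite (le_trans (ler_normD _ _))// !normrM (ger0_norm a0) (ger0_norm y0).
by rewrite lerD ?ler_piMr// (le_trans _ abs)// ler_piMl.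
Qed.

End Averages.

(** * The second moment method *)

Definition prob (R : realFieldType) (O : finType) (p : O -> R) (Q : pred O) :=
  \sum_(g | Q g) p g.

Lemma prob_ge0 (R : realFieldType) (O : finType) (p : O -> R) Q :
  (forall g, 0 <= p g) -> 0 <= prob p Q.
Proof. by move=> p0; apply: sumr_ge0. Qed.

Lemma ler_prob (R : realFieldType) (O : finType) (p : O -> R) (Q Q' : pred O) :
  (forall g, 0 <= p g) -> (forall g, Q g -> Q' g) -> prob p Q <= prob p Q'.
Proof.
move=> p0 QQ'; rewrite /prob [leRHS](bigID Q)/= -[leLHS]addr0 lerD ?sumr_ge0//.
rewrite le_eqVlt; apply/orP; left; apply/eqP/eq_bigl => g.
by case: (boolP (Q g)) => [/QQ' ->|]; rewrite ?andbF.
Qed.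

Lemma prob_le1 (R : realFieldType) (O : finType) (p : O -> R) Q :
  (forall g, 0 <= p g) -> \sum_g p g = 1 -> prob p Q <= 1.
Proof. by move=> p0 <-; apply: (@ler_prob _ _ p Q xpredT). Qed.

Lemma prob_has (R : realFieldType) (O : finType) (U : Type) (p : O -> R)
    (s : seq U) (Q : U -> pred O) : (forall g, 0 <= p g) ->
  prob p (fun g => has (fun o => Q o g) s) <= \sum_(o <- s) prob p (Q o).
Proof.
move=> p0; elim: s => [|o s IH]; first by rewrite /prob big_nil big_pred0.
rewrite big_cons /= (le_trans _ (lerD (lexx _) IH))//.
rewrite /prob !(big_mkcond (fun g => _ || _)) [in leRHS]big_mkcond.
rewrite [X in _ + X]big_mkcond -big_split/=; apply: ler_sum => g _.
by case: (Q o g); case: (has _ _); rewrite ?addr0 ?add0r ?lerDl.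
Qed.

Section SecondMoment.
Context {R : realFieldType} {O I : finType} (p : O -> R) (X : I -> pred O).
Hypothesis p_ge0 : forall g, 0 <= p g.
Hypothesis p_sum1 : \sum_g p g = 1.

(** Chebyshev's inequality: the second moment about [t] is the variance, which
    is the average covariance of the events, plus the squared bias. *)
Lemma chebyshev_avg (t e b c : R) : 0 < e ->
  `|avg (fun i => prob p (X i)) - t| <= b ->
  avg (fun i => avg (fun j =>
    prob p (fun g => X i g && X j g) - prob p (X i) * prob p (X j))) <= c ->
  prob p [pred g | e <= `|avg (fun i => (X i g)%:R) - t|]
  <= (c + b ^+ 2) / e ^+ 2.
Proof.
move=> e0 tb cov; pose h g := avg (fun i => (X i g)%:R : R).
have b0 : 0 <= b by exact: le_trans tb.
rewrite ler_pdivlMr ?exprn_gt0//.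
apply: (@le_trans _ _ (\sum_g p g * (h g - t) ^+ 2)).
  rewrite /prob mulr_suml [leRHS](bigID [pred g | e <= `|h g - t|])/=.
  rewrite -[leLHS]addr0 lerD// ?sumr_ge0//.
    apply: ler_sum => g eg; rewrite ler_wpM2l// -[leRHS]real_normK ?num_real//.
    by rewrite lerXn2r ?nnegrE ?(ltW e0).
  by move=> g _; rewrite mulr_ge0 ?sqr_ge0.
have probE Q : prob p Q = \sum_g p g * (Q g)%:R.
  rewrite /prob big_mkcond/=; apply: eq_bigr => g _.
  by case: (Q g); rewrite ?mulr1 ?mulr0.
have E1 : avg (fun i => prob p (X i)) = \sum_g p g * h g.
  rewrite (eq_avg (fun i => probE (X i))) avg_sum; apply: eq_bigr => g _.
  by rewrite avgZ.
have E2 : avg (fun i => avg (fun j => prob p (fun g => X i g && X j g)))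
          = \sum_g p g * (h g * h g).
  rewrite (eq_avg (g := fun i => \sum_g p g * ((X i g)%:R * h g))).
    rewrite avg_sum; apply: eq_bigr => g _; rewrite avgZ; congr (_ * _).
    by rewrite -avgZ; apply: eq_avg => i; rewrite mulrC.
  move=> i; rewrite (eq_avg (fun j => probE _)) avg_sum.
  apply: eq_bigr => g _; rewrite avgZ; congr (_ * _); rewrite -avgZ.
  by apply: eq_avg => j; rewrite /= -natrM mulnb.
set m := avg _ in tb E1.
have E3 : avg (fun i => avg (fun j => prob p (X i) * prob p (X j))) = m * m.
  rewrite -avgZ; apply: eq_avg => i.
  by rewrite avgZ mulrC.
have {cov} cov : \sum_g p g * (h g * h g) - m * m <= c.
  rewrite -E2 -E3 -avgN -avgD; apply: le_trans cov.
  by apply: ler_avg => i; rewrite -avgN -avgD.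
have -> : \sum_g p g * (h g - t) ^+ 2
    = \sum_g p g * (h g * h g) - 2 * t * m + t ^+ 2.
  have -> : t ^+ 2 = \sum_g t ^+ 2 * p g by rewrite -mulr_sumr p_sum1 mulr1.
  rewrite E1 mulr_sumr -sumrN -!big_split.
  by apply: eq_bigr => g _ /=; ring.
have : (m - t) ^+ 2 <= b ^+ 2.
  by rewrite -[leLHS]real_normK ?num_real// lerXn2r ?nnegrE.
move: cov; set S := \sum_g _; move=> cov hb; nra.
Qed.

End SecondMoment.

(** * Moments and sampling without replacement *)

Lemma integral_itv01 d (S : measurableType d) (R : realType)
    (mu : probability S R) (f : S -> R) :
  measurable_fun setT f -> (forall x, 0 <= f x <= 1) ->
  (0 <= \int[mu]_x (f x)%:E <= 1)%E.
Proof.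
move=> mf f01; apply/andP; split.
  by apply: integral_ge0 => x _; rewrite lee_fin; case/andP: (f01 x).
apply: (@le_trans _ _ (\int[mu]_x (cst 1%:E) x)%E); last first.
  by rewrite integral_cst//= mul1e probability_setT.
apply: ge0_le_integral => //=.
- by move=> x _; rewrite lee_fin; case/andP: (f01 x).
- exact/measurable_EFinP.
- by move=> x _; rewrite lee_fin; case/andP: (f01 x).
Qed.

Section Moments.
Context {R : realType}.

(** The test functions [clamp x ^+ c] are bounded and continuous on the whole
    line, and agree with [x ^+ c] on [0, 1], where all the laws live. *)
Definition clamp (x : R) : R := Num.max 0 (Num.min x 1).

Lemma clamp01 (x : R) : 0 <= clamp x <= 1.
Proof. by rewrite /clamp le_max lexx ge_max ler01 ge_min lexx orbT. Qed.

Lemma clampE (x : R) : 0 <= x <= 1 -> clamp x = x.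
Proof. by case/andP => x0 x1; rewrite /clamp min_l// max_r. Qed.

Lemma clampX01 c (x : R) : 0 <= clamp x ^+ c <= 1.
Proof. by have /andP[? ?] := clamp01 x; rewrite exprn_ge0// exprn_ile1. Qed.

Lemma continuous_clampX c : continuous (fun x : R => clamp x ^+ c).
Proof.
move=> x; apply: (continuous_comp (f := clamp) (g := fun y => y ^+ c)).
  apply: continuous_max; first exact: cvg_cst.
  by apply: continuous_min; [exact: cvg_id|exact: cvg_cst].
exact: exprn_continuous.
Qed.

Lemma measurable_clampX c : measurable_fun setT (fun x : R => clamp x ^+ c).
Proof. apply: continuous_measurable_fun; exact: continuous_clampX. Qed.

Context (nu : probability R R).

Definition moment (c : nat) : R := fine (\int[nu]_x (clamp x ^+ c)%:E)%E.

Lemma momentE c : (\int[nu]_x (clamp x ^+ c)%:E)%E = (moment c)%:E.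
Proof.
have /andP[h0 h1] := integral_itv01 nu (measurable_clampX c) (clampX01 c).
by rewrite fineK// ge0_fin_numE// (le_lt_trans h1)// ltry.
Qed.

Lemma moment01 c : 0 <= moment c <= 1.
Proof.
rewrite -!lee_fin -momentE.
exact: integral_itv01 (measurable_clampX c) (clampX01 c).
Qed.

(** A uniform [k]-subset of an [m]-set contains [c] given points with the
    probability on the left, that is, when they are drawn one after the other
    without replacement. *)
Lemma bin_ratio (m k c : nat) : (k <= m)%N ->
  (c <= k)%:R * 'C(m - c, k - c)%:R / 'C(m, k)%:R =
  \prod_(l < c) ((k - l)%:R / (m - l)%:R) :> R.
Proof.
move=> km; elim: c => [|c IH].
  by rewrite big_ord0 !subn0 leq0n mul1r divff// pnatr_eq0 -lt0n bin_gt0.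
rewrite big_ord_recr /= -IH; case: (ltnP c k) => ck; last first.
  by rewrite (eqP ck) mul0r !mul0r mulr0.
rewrite (ltnW ck) !mul1r mulrAC; congr (_ / _).
have mc : (m - c)%:R != 0 :> R.
  by rewrite pnatr_eq0 subn_eq0 -ltnNge (leq_trans ck).
rewrite mulrA; apply: (canRL (mulfK mc)); rewrite -!natrM; congr (_%:R).
have := mul_bin_diag (m - c) (k - c.+1).
by rewrite -subnS mulnC => ->; rewrite mulnC -subSn// subSS.
Qed.

Lemma ratio01 (k m l : nat) : (k <= m)%N ->
  0 <= ((k - l)%:R / (m - l)%:R : R) <= 1.
Proof.
move=> km; rewrite divr_ge0//=.
have [->|ml] := posnP (m - l); first by rewrite invr0 mulr0.
by rewrite ler_pdivrMr ?ltr0n// mul1r ler_nat leq_sub2r.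
Qed.

(** Drawing without replacement is close to drawing with replacement; the
    denominator [m.+1] is that of the normalization of the degrees. *)
Lemma ratio_dist (m k l : nat) : (l < m)%N -> (k <= m)%N ->
  `|(k - l)%:R / (m - l)%:R - k%:R / m.+1%:R| <= l.+1%:R / (m - l)%:R :> R.
Proof.
move=> lm km.
have m0 : 0 < m.+1%:R :> R by [].
have d0 : 0 < (m - l)%:R :> R by rewrite ltr0n subn_gt0.
have dE : (m - l)%:R = m%:R - l%:R :> R by rewrite natrB// ltnW.
have kmR : k%:R <= m%:R :> R by rewrite ler_nat.
have k0 : 0 <= k%:R :> R by [].
have l0 : 0 <= l%:R :> R by [].
have [lk|kl] := leqP l k; last first.
  rewrite (eqP (ltnW kl)) mul0r sub0r normrN ger0_norm ?divr_ge0//.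
  rewrite ler_pdivrMr// mulrAC ler_pdivlMr//.
  have : k%:R <= l%:R :> R by rewrite ler_nat ltnW.
  rewrite dE -[l.+1%:R]natr1 -[m.+1%:R]natr1; nra.
have -> : (k - l)%:R / (m - l)%:R - k%:R / m.+1%:R =
  (k%:R * l.+1%:R - l%:R * m.+1%:R) / (m.+1%:R * (m - l)%:R) :> R.
  rewrite natrB// -[l.+1%:R]natr1 -[m.+1%:R]natr1.
  move: d0; rewrite dE -[m.+1%:R]natr1 in m0 * => d0.
  by field; rewrite !gt_eqF.
rewrite normrM [X in _ * X]ger0_norm ?invr_ge0 ?mulr_ge0//.
rewrite ler_pdivrMr ?mulr_gt0//.
rewrite [leRHS](_ : _ = l.+1%:R * m.+1%:R); last first.
  by rewrite [m.+1%:R * _]mulrC mulrA divfK ?gt_eqF.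
have lkR : l%:R <= k%:R :> R by rewrite ler_nat.
rewrite ler_norml -[l.+1%:R]natr1 -[m.+1%:R]natr1.
apply/andP; split; nra.
Qed.

End Moments.

Lemma card_supersets (O : finType) (S : {set O}) k :
  #|[set A : {set O} | S \subset A & #|A| == k]%SET| =
  ((#|S| <= k) * 'C(#|O| - #|S|, k - #|S|))%N.
Proof.
case: leqP => Sk; last first.
  apply/eqP; rewrite cards_eq0; apply/eqP/setP => A; rewrite !inE.
  by apply/negP => /andP[/subset_leq_card + /eqP Ak]; rewrite Ak leqNgt Sk.
rewrite mul1n -[(#|O| - _)%N](_ : #|~: S| = _); last first.
  by rewrite cardsCs finset.setCK.
rewrite -cards_draws.
pose f (A : {set O}) := A :|: S.
(* Adding [S] is a bijection from the subsets of its complement. *)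
rewrite -[RHS](@card_in_imset _ _ f); last first.
  move=> A B; rewrite !inE => /andP[AS _] /andP[BS _].
  move=> /(congr1 (fun C => C :\: S)).
  rewrite /f !finset.setDUl finset.setDv !finset.setU0.
  by rewrite !finset.setDE (finset.setIidPl AS) (finset.setIidPl BS).
apply: eq_card => A; rewrite inE; apply/andP/imsetP => [[SA /eqP Ak]|[B]].
  exists (A :\: S); last first.
    by rewrite /f finset.setUC -{1}(finset.setID A S) (finset.setIidPr SA).
  by rewrite inE finset.subsetDr cardsD (finset.setIidPr SA) Ak eqxx.
rewrite inE => /andP[BS /eqP Bk] ->; split; first exact: finset.subsetUr.
rewrite /f cardsU Bk (_ : B :&: S = finset.set0) ?cards0 ?subn0 ?subnK//.
by apply/eqP; rewrite finset.setI_eq0 finset.disjoints_subset.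
Qed.

(** * Homomorphisms into the growing graph *)

Lemma adjC k (F : sgraph k) i j : adj F i j = adj F j i.
Proof.
by case: F => E EP; have /andP[_ /forallP/(_ i)/forallP/(_ j)/eqP] := EP.
Qed.

Lemma adjxx k (F : sgraph k) i : adj F i i = false.
Proof. by case: F => E EP; have /andP[/forallP/(_ i)/negbTE] := EP. Qed.

Definition is_hom k n (F : sgraph k) (phi : {ffun 'I_k -> 'I_n})
    (G : sgraph n) :=
  [forall i, forall j, adj F i j ==> adj G (phi i) (phi j)].

Lemma hom_density_avg (R : realType) k n (F : sgraph k) (G : sgraph n) :
  hom_density R F G = avg (fun phi => (is_hom F phi G)%:R).
Proof.
rewrite /hom_density /avg -natr_sum; congr (_%:R / _).
by rewrite -sum1_card big_mkcond; apply: eq_bigr => phi _; rewrite inE.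
Qed.

Definition loopfree k n (F : sgraph k) (phi : {ffun 'I_k -> 'I_n}) :=
  [forall u, forall v, adj F u v ==> (phi u != phi v)].

Lemma injective_loopfree k n (F : sgraph k) (phi : {ffun 'I_k -> 'I_n}) :
  injective phi -> loopfree F phi.
Proof.
move=> phiI; apply/forallP => u; apply/forallP => v; apply/implyP => uv.
by apply/eqP => /phiI uv'; rewrite uv' adjxx in uv.
Qed.

(** What vertex [m] has to choose at its arrival if [phi] is to be a
    homomorphism.  Time is a natural number here, so that these sets can be
    compared with the steps of the construction. *)
Definition required k n (F : sgraph k) (phi : {ffun 'I_k -> 'I_n}) (m : nat) :
    {set 'I_m} :=
  [set l : 'I_m | [exists u, exists v,
     [&& adj F u v, phi u == l :> nat & phi v == m :> nat]]]%SET.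

Definition older_degree k n (F : sgraph k) (phi : {ffun 'I_k -> 'I_n}) v :=
  #|[set u | adj F u v && (phi u < phi v)%N]%SET|.

Lemma card_required k n (F : sgraph k) (phi : {ffun 'I_k -> 'I_n}) v :
  injective phi -> #|required F phi (phi v)| = older_degree F phi v.
Proof.
move=> phiI; rewrite /older_degree.
set S := [set u | _]%SET.
have wI : injective (widen_ord (ltnW (ltn_ord (phi v)))).
  by move=> l l' /(congr1 val)/= /val_inj.
rewrite -(card_imset _ wI) -(card_imset S phiI).
apply: eq_card => x; apply/imsetP/imsetP.
  move=> [l]; rewrite inE => /existsP[u /existsP[v' /and3P[uv /eqP e /eqP e']]].
  move=> ->; exists u; last exact/val_inj.
  have vv' : v' = v by exact/phiI/val_inj.
  by rewrite inE -vv' uv e vv' ltn_ord.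
move=> [u]; rewrite inE => /andP[uv lt_uv] ->.
exists (Ordinal lt_uv); last exact/val_inj.
rewrite inE; apply/existsP; exists u; apply/existsP; exists v.
by rewrite uv !eqxx.
Qed.

Lemma required_eq0 k n (F : sgraph k) (phi : {ffun 'I_k -> 'I_n}) (m : 'I_n) :
  m \notin codom phi -> required F phi m = finset.set0.
Proof.
move=> mphi; apply/setP => l; rewrite !inE; apply/negbTE/negP.
move=> /existsP[u /existsP[v /and3P[_ _ /eqP e]]].
by move/negP: mphi; apply; apply/codomP; exists v; exact/val_inj.
Qed.

(** The vertex [x] is a plain number, as vertices of graphs of different sizes
    have different types. *)
Definition chosen (N : forall n, {set 'I_n.-1}) (m x : nat) : bool :=
  [exists l : 'I_m, (l == x :> nat) && (l \in N m.+1)].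

Lemma adj_growth (N : forall n, {set 'I_n.-1}) n (i j : 'I_n) : (i < j)%N ->
  adj (growth N n) i j = chosen N j i.
Proof.
elim: n i j => [[]//|n IH] i j /=.
rewrite /adj /= inE /add_vertex_adj /=.
case: (unliftP ord_max i) => [i'|] ->; case: (unliftP ord_max j) => [j'|] ->;
  rewrite ?lift_max //=; last 2 first.
- by move=> /(ltn_trans (ltn_ord j')); rewrite ltnn.
- by rewrite ltnn.
- by move=> ij; rewrite -IH.
move=> _; apply/idP/existsP => [iN|[l /andP[/eqP li]]].
  by exists i'; rewrite eqxx.
by rewrite (_ : l = i')//; exact/val_inj.
Qed.

(** Each edge of [F] is the business of the younger of its two image vertices,
    which are distinct for a loop-free map. *)
Lemma is_hom_growth (N : forall n, {set 'I_n.-1}) k n (F : sgraph k)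
    (phi : {ffun 'I_k -> 'I_n}) :
  is_hom F phi (growth N n) =
  loopfree F phi && [forall m : 'I_n, required F phi m \subset N m.+1].
Proof.
apply/idP/andP => [homF|[/forallP lf /forallP req]].
  have {}homF u v : adj F u v -> adj (growth N n) (phi u) (phi v).
    by move: homF => /forallP/(_ u)/forallP/(_ v)/implyP.
  split.
    apply/forallP => u; apply/forallP => v; apply/implyP => /homF.
    by apply: contraL => /eqP ->; rewrite adjxx.
  apply/forallP => m; apply/fintype.subsetP => l; rewrite inE.
  move=> /existsP[u /existsP[v /and3P[/homF + /eqP ul /eqP /val_inj vm]]].
  rewrite vm adj_growth ul// => /existsP[l' /andP[/eqP /val_inj ->]].
  by [].
have hom_lt u v : adj F u v -> (phi u < phi v)%N ->
    adj (growth N n) (phi u) (phi v).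
  move=> uv lt_uv; rewrite adj_growth//; apply/existsP; exists (Ordinal lt_uv).
  rewrite eqxx /=; move/fintype.subsetP: (req (phi v)); apply; rewrite inE.
  by apply/existsP; exists u; apply/existsP; exists v; rewrite uv !eqxx.
apply/forallP => u; apply/forallP => v; apply/implyP => uv.
move: (lf u) => /forallP/(_ v); rewrite uv /= neq_ltn => /orP[lt_uv|lt_vu].
  exact: hom_lt.
by rewrite adjC hom_lt// adjC.
Qed.

(** * The law of the growing graph *)

Section FiniteValued.
Context d (T : measurableType d) (R : realType) (P : probability T R).
Context (O : finType) (X : T -> O).
Hypothesis mX : forall g, measurable [set w | X w = g].

Lemma measurable_finite_valued (Q : pred O) : measurable [set w | Q (X w)].
Proof.
have -> : [set w | Q (X w)] = \bigcup_(g in [set g | Q g]) [set w | X w = g].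
  by apply/seteqP; split => [w Qw|w [g Qg /= ->//]]; exists (X w).
exact: fin_bigcup_measurable.
Qed.

Lemma prob_finite_valued (Q : pred O) :
  P [set w | Q (X w)] = (prob (fun g => fine (P [set w | X w = g])) Q)%:E.
Proof.
pose f g := fine (P [set w | X w = g]).
have fE g : (f g)%:E = P [set w | X w = g] by rewrite fineK ?fin_num_measure.
have H (s : seq O) : uniq s -> P [set w | X w \in s] = (\sum_(g <- s) f g)%:E.
  elim: s => [_|g s IH /= /andP[gs us]].
    rewrite big_nil; rewrite [X in P X](_ : _ = set0) ?measure0//.
    by apply/seteqP; split.
  rewrite big_cons EFinD fE -(IH us) -measureU//; last first.
  - by apply/seteqP; split => // w [/= ->]; rewrite (negbTE gs).
  - exact: (measurable_finite_valued (mem s)).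
  congr (P _); apply/seteqP; split => w /=; rewrite inE.
    by case/orP => [/eqP|]; [left|right].
  by case => [->|->]; rewrite ?eqxx ?orbT.
rewrite /prob -[X in _ = X%:E]big_enum -H ?enum_uniq//.
by congr (P _); apply/seteqP; split => w /=; rewrite mem_enum.
Qed.

End FiniteValued.

Section GrowingSteps.
Context (R : realType) (d : measure_display) (T : measurableType d).
Context (P : probability T R) (nu_ : nat -> probability nat R).
Context (D : nat -> T -> nat) (N : forall n : nat, T -> {set 'I_n.-1}).
Hypothesis nu_supp :
  forall n : nat, (1 <= n)%N -> nu_ n [set k : nat | (k < n)%N] = 1%E.
Hypothesis steps : growing_steps P nu_ D N.

Let gr n (w : T) : sgraph n := growth (fun m : nat => N m w) n.

Lemma set_ord0 (A B : {set 'I_0}) : A = B.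
Proof. by apply/setP => -[]. Qed.

Lemma measurable_neighbourhood m (A : {set 'I_m}) :
  measurable [set w | N m.+1 w = A].
Proof.
case: m A => [|m] A.
  rewrite (_ : mkset _ = setT)//.
  by apply/seteqP; split => // w _; exact: set_ord0.
rewrite (_ : mkset _ = \bigcup_k [set w | D m.+2 w = k /\ N m.+2 w = A]).
  by apply: bigcup_measurable => k _; exact: (steps_measurable steps).
by apply/seteqP; split => [w NA|w [k _ []//]]; exists (D m.+2 w).
Qed.

Lemma measurable_growth n (g : sgraph n) : measurable [set w | gr n w = g].
Proof.
elim: n g => [|n IH] g.
  have -> : [set w | gr 0 w = g] = [set w | empty_sgraph 0 == g].
    by apply/seteqP; split => w /= /eqP.
  case: (_ == g); first by rewrite (_ : mkset _ = setT)//; exact/seteqP.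
  by rewrite (_ : mkset _ = set0)//; apply/seteqP; split.
rewrite (_ : mkset _ = [set w |
  (fun gA => add_vertex gA.1 gA.2 == g) (gr n w, N n.+1 w)]); last first.
  by apply/seteqP; split => w /= /eqP.
apply: (measurable_finite_valued (X := fun w => (gr n w, N n.+1 w)) _
  (fun gA => add_vertex gA.1 gA.2 == g)) => -[g' A].
rewrite (_ : mkset _ = [set w | gr n w = g'] `&` [set w | N n.+1 w = A]).
  by apply: measurableI; [exact: IH|exact: measurable_neighbourhood].
by apply/seteqP; split => w /= [-> ->].
Qed.

(** Only finitely many graphs have [n] vertices, so that finite sums over this
    law can replace integrals over the probability space. *)
Definition law n (g : sgraph n) : R := fine (P [set w | gr n w = g]).

Lemma lawE n (Q : pred (sgraph n)) :
  P [set w | Q (gr n w)] = (prob (@law n) Q)%:E.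
Proof. exact/prob_finite_valued/measurable_growth. Qed.

Lemma law_ge0 n g : 0 <= @law n g.
Proof. exact/fine_ge0. Qed.

Lemma law_sum1 n : \sum_g @law n g = 1.
Proof.
have := lawE (fun _ : sgraph n => true).
by rewrite (_ : mkset _ = setT) ?probability_setT; [case|exact/seteqP].
Qed.

(** Mutual independence of the steps follows by induction from the independence
    of each step from all the earlier ones. *)
Lemma prob_neighbourhoods (Q : forall m, pred {set 'I_m}) n :
  P [set w | forall m, (m < n)%N -> Q m (N m.+1 w)] =
  (\prod_(m < n) P [set w | Q m (N m.+1 w)])%E.
Proof.
elim: n => [|n IH].
  rewrite big_ord0 (_ : mkset _ = setT) ?probability_setT//.
  exact/seteqP.
rewrite big_ord_recr /= -IH.
rewrite (_ : [set w | forall m, (m < n.+1)%N -> _] =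
  [set w | forall m, (m < n)%N -> Q m (N m.+1 w)] `&` [set w | Q n (N n.+1 w)]);
  last first.
  apply/seteqP; split => [w QN|w [QN Qn] m].
    by split => [m mn|]; apply: QN; rewrite // (ltn_trans mn).
  by rewrite ltnS leq_eqVlt => /predU1P[->//|/QN].
(* The choice of the first vertex is constant, hence not among the steps. *)
case: n {IH} => [|n].
  rewrite (_ : [set w | forall m, _ -> _] = setT); last exact/seteqP.
  by rewrite setTI probability_setT mul1e.
rewrite setIC muleC.
have := steps_indep steps (isT : (1 < n.+2)%N)
  [set p : nat * {set 'I_n.+1} | Q n.+1 p.2]
  [set f : forall i : 'I_n, nat * {set 'I_i.+1} |
     Q 0%N finset.set0 /\ forall i : 'I_n, Q i.+1 (f i).2].
have -> // : earlier_steps D N n.+2 @^-1` [set f : forall i : 'I_n, _ |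
     Q 0%N finset.set0 /\ forall i : 'I_n, Q i.+1 (f i).2] =
   [set w | forall m, (m < n.+1)%N -> Q m (N m.+1 w)].
apply/seteqP; split => [w /= [Q0 Qi] [|m] mn|w /= Qm].
- by rewrite (set_ord0 (N 1 w) finset.set0).
- exact: (Qi (@Ordinal n m mn)).
- split; first by rewrite (set_ord0 finset.set0 (N 1 w)); exact: Qm.
  by move=> i; apply: Qm; rewrite ltnS.
Qed.

(** The average, over the degree [k] of vertex [m], of the probability that a
    uniform [k]-subset of its [m] predecessors contains [c] given ones. *)
Definition attach (m c : nat) : R :=
  \sum_(k < m.+1)
    fine (nu_ m.+1 [set val k]) *
    ((c <= k)%:R * 'C(m - c, k - c)%:R / 'C(m, k)%:R).

(** Given its size [k], the neighbourhood is a uniform [k]-subset, and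
    [card_supersets] counts those that contain [S]. *)
Lemma prob_attach m (S : {set 'I_m}) :
  P [set w | S \subset N m.+1 w] = (attach m #|S|)%:E.
Proof.
case: m S => [|m] S.
  rewrite /attach big_ord1 (_ : #|S| = 0)%N; last first.
    by apply/eqP; rewrite cards_eq0; apply/eqP/set_ord0.
  rewrite !bin0 leqnn divr1 !mulr1 fineK ?fin_num_measure//.
  rewrite (_ : [set w | _] = setT) ?probability_setT.
    rewrite -(nu_supp (isT : (0 < 1)%N)); congr (nu_ 1%N _).
    by apply/seteqP; split => k /=; [case: k|move=> ->].
  apply/seteqP; split => // w _ /=.
  by rewrite (set_ord0 S finset.set0) finset.sub0set.
(* The degree is almost surely at most [m.+1]; the extra value [m.+2] collects
   the exceptions, so that the step takes finitely many values. *)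
pose X w : 'I_m.+3 * {set 'I_m.+1} := (inord (minn (D m.+2 w) m.+2), N m.+2 w).
have preX (k : 'I_m.+3) A : (k < m.+2)%N ->
    [set w | X w = (k, A)] = [set w | D m.+2 w = k /\ N m.+2 w = A].
  move=> km; apply/seteqP; split => w /=.
    move=> [/(congr1 val)/= + ->]; rewrite inordK ?ltnS ?geq_minr//.
    move=> e; split => //; move: e km; rewrite /minn.
    by case: ltnP => // _ <-; rewrite ltnn.
  move=> [DE NE]; rewrite /X NE; congr (_, _); apply: val_inj.
  rewrite /= DE (minn_idPl _) ?inordK//; exact: ltnW.
have D_large : P [set w | (m.+2 <= D m.+2 w)%N] = 0%E.
  have -> : [set w | (m.+2 <= D m.+2 w)%N] =
      D m.+2 @^-1` ~` [set k | (k < m.+2)%N].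
    apply/seteqP; split => w /=; first by rewrite leqNgt => /negP.
    by move=> /negP; rewrite -leqNgt.
  by rewrite (steps_degree steps)// probability_setC// nu_supp// subee.
have mD (B : set nat) : measurable (D m.+2 @^-1` B).
  rewrite (_ : _ @^-1` _ = \bigcup_(k in B) \bigcup_(A in [set: {set 'I_m.+1}])
      [set w | D m.+2 w = k /\ N m.+2 w = A]).
    apply: bigcup_measurable => k _; apply: fin_bigcup_measurable => // A _.
    exact: (steps_measurable steps).
  apply/seteqP; split => [w BD|w [k Bk [A _ [/= -> _]]]//].
  by exists (D m.+2 w) => //; exists (N m.+2 w).
have preXmax A : [set w | X w = (ord_max, A)] =
    (D m.+2 @^-1` [set k | (m.+2 <= k)%N]) `&` [set w | N m.+2 w = A].
  apply/seteqP; split => w /=.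
    move=> [/(congr1 val)/= + ->]; rewrite inordK ?ltnS ?geq_minr// => e.
    by split=> //; apply/minn_idPr.
  move=> [DE NE]; rewrite /X NE; congr (_, _); apply: val_inj.
  by rewrite /= (minn_idPr DE) inordK.
have mX kA : measurable [set w | X w = kA].
  case: kA => k A; case: (ltnP k m.+2) => km.
    by rewrite preX//; exact: (steps_measurable steps).
  have -> : k = ord_max by apply/val_inj/anti_leq; rewrite km -ltnS ltn_ord.
  by rewrite preXmax; apply: measurableI => //; exact: measurable_neighbourhood.
rewrite (prob_finite_valued P mX (fun kA => S \subset kA.2)); congr EFin.
have -> : prob (fun kA => fine (P [set w | X w = kA]))
      (fun kA => S \subset kA.2) =
    \sum_k \sum_(A : {set 'I_m.+1} | S \subset A)
      fine (P [set w | X w = (k, A)]).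
  by rewrite pair_big_dep; apply: eq_big => [[k A]|[k A] _].
rewrite big_ord_recr /= [X in _ + X]big1 ?addr0; last first.
  move=> A _; rewrite preXmax; apply/eqP; rewrite eq_le fine_ge0// andbT.
  have mDmax := mD [set k | (m.+2 <= k)%N].
  have mDN := measurableI _ _ mDmax (measurable_neighbourhood A).
  rewrite -[leRHS]/(fine 0%E) -D_large fine_le ?fin_num_measure//.
  by rewrite le_measure ?inE//; exact: subIsetl.
rewrite /attach; apply: eq_bigr => k _.
have kE (A : {set 'I_m.+1}) :
    fine (P [set w | X w = (widen_ord (leqnSn m.+2) k, A)]) =
    fine (nu_ m.+2 [set val k]) * ((#|A| == k)%:R / 'C(m.+1, k)%:R).
  rewrite preX//= (steps_uniform steps)//=.
  rewrite -[X in P X]/(D m.+2 @^-1` [set val k]) (steps_degree steps)//.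
  rewrite fineM ?fin_num_measure//; congr (_ * _).
  by case: (_ == _); rewrite /= ?mul1r ?mul0r.
rewrite (eq_bigr _ (fun A _ => kE A)) -mulr_sumr -mulr_suml.
congr (_ * (_ / _)); rewrite -natrM -[X in (X - _)%N](card_ord m.+1).
rewrite -card_supersets -sum1_card natr_sum.
rewrite big_mkcond [RHS]big_mkcond /=; apply: eq_bigr => A _.
by rewrite inE; case: (S \subset A); case: (_ == _).
Qed.

Lemma attach0 m : attach m 0 = 1.
Proof.
have := prob_attach (finset.set0 : {set 'I_m}).
rewrite cards0 (_ : mkset _ = setT) ?probability_setT; first by case.
by apply/seteqP; split => // w _ /=; rewrite finset.sub0set.
Qed.

Definition both_hom k n (F : sgraph k) (phi psi : {ffun 'I_k -> 'I_n})
  (g : sgraph n) := is_hom F phi g && is_hom F psi g.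

(** Vertex [m] has to choose all that is required by [phi] or by [psi],
    independently for different [m]. *)
Lemma prob_both_hom k n (F : sgraph k) (phi psi : {ffun 'I_k -> 'I_n}) :
  prob (@law n) (both_hom F phi psi) =
  (loopfree F phi && loopfree F psi)%:R *
  \prod_(m < n) attach m #|required F phi m :|: required F psi m|.
Proof.
apply: EFin_inj; rewrite -lawE.
case: (boolP (loopfree F phi && loopfree F psi)) => lf; last first.
  rewrite mul0r (_ : mkset _ = set0) ?measure0//.
  apply/seteqP; split => // w /=.
  rewrite /both_hom /gr !is_hom_growth; case/andP => /andP[l1 _] /andP[l2 _].
  by rewrite l1 l2 in lf.
rewrite mul1r -prodEFin.
rewrite [RHS](eq_bigr (fun m : 'I_n => P [set w |
  required F phi m :|: required F psi m \subset N m.+1 w])); last first.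
  by move=> m _; rewrite prob_attach.
rewrite -(prob_neighbourhoods (fun m A =>
  required F phi m :|: required F psi m \subset A)).
congr (P _); apply/seteqP; split => w /=; rewrite /both_hom /gr !is_hom_growth.
  case/andP: lf => -> -> /= /andP[/forallP h1 /forallP h2] m mn.
  by rewrite finset.subUset (h1 (Ordinal mn)) (h2 (Ordinal mn)).
case/andP: lf => -> -> /= h; apply/andP; split; apply/forallP => m;
  by have := h m (ltn_ord m); rewrite finset.subUset => /andP[].
Qed.

Lemma prob_is_hom k n (F : sgraph k) (phi : {ffun 'I_k -> 'I_n}) :
  prob (@law n) (is_hom F phi) =
  (loopfree F phi)%:R * \prod_(m < n) attach m #|required F phi m|.
Proof.
have -> : prob (@law n) (is_hom F phi) = prob (@law n) (both_hom F phi phi).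
  by apply: eq_bigl => g; rewrite /both_hom andbb.
rewrite prob_both_hom andbb; congr (_ * _).
by apply: eq_bigr => m _; rewrite finset.setUid.
Qed.

(** If the images are disjoint, no vertex has obligations from both maps, so the
    product over the vertices factors. *)
Lemma prob_both_hom_disjoint k n (F : sgraph k)
    (phi psi : {ffun 'I_k -> 'I_n}) :
  ~~ [exists i, exists j, phi i == psi j] ->
  prob (@law n) (both_hom F phi psi) =
  prob (@law n) (is_hom F phi) * prob (@law n) (is_hom F psi).
Proof.
move=> disj; rewrite prob_both_hom !prob_is_hom -mulnb natrM mulrACA.
congr (_ * _); rewrite -big_split; apply: eq_bigr => m _ /=.
have [/codomP[i mi]|mphi] := boolP (m \in codom phi); last first.
  by rewrite (required_eq0 F mphi) finset.set0U cards0 attach0 mul1r.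
rewrite (@required_eq0 _ _ F psi) ?finset.setU0 ?cards0 ?attach0 ?mulr1//.
apply: contra disj => /codomP[j mj].
by apply/existsP; exists i; apply/existsP; exists j; rewrite -mi mj.
Qed.

(** Vertices outside the image are free to choose anything. *)
Lemma prob_injective_hom k n (F : sgraph k) (phi : {ffun 'I_k -> 'I_n}) :
  injective phi ->
  prob (@law n) (is_hom F phi) = \prod_v attach (phi v) (older_degree F phi v).
Proof.
move=> phiI; rewrite prob_is_hom injective_loopfree// mul1r.
rewrite (bigID [pred m | m \in [set phi v | v in [set: 'I_k]]%SET])/=.
rewrite [X in _ * X]big1 ?mulr1; last first.
  move=> m mphi; rewrite (@required_eq0 _ _ F phi) ?cards0 ?attach0//.
  apply: contra mphi => /codomP[v ->]; exact: imset_f.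
rewrite big_imset /=; last by move=> ? ? _ _; exact: phiI.
rewrite (eq_bigl xpredT) => [|v]; last by rewrite inE.
by apply: eq_bigr => v _; rewrite card_required.
Qed.

Lemma attachE m c : attach m c =
  \sum_(k < m.+1) fine (nu_ m.+1 [set val k]) *
    \prod_(l < c) ((k - l)%:R / (m - l)%:R).
Proof. by apply: eq_bigr => k _; rewrite bin_ratio// -ltnS. Qed.

Lemma nu_sum1 m : \sum_(k < m.+1) fine (nu_ m.+1 [set val k]) = 1.
Proof.
rewrite -(attach0 m) attachE.
by apply: eq_bigr => k _; rewrite big_ord0 mulr1.
Qed.

Lemma attach01 m c : 0 <= attach m c <= 1.
Proof.
have p01 (k : 'I_m.+1) :
    0 <= (\prod_(l < c) ((k - l)%:R / (m - l)%:R) : R) <= 1.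
  have r01 l := @ratio01 R k m l (leq_ord k).
  by rewrite prodr_ge0 ?prodr_ile1// => l _; case/andP: (r01 l).
rewrite attachE sumr_ge0//= => [|k _]; last first.
  by rewrite mulr_ge0 ?fine_ge0//; case/andP: (p01 k).
rewrite -[leRHS](nu_sum1 m); apply: ler_sum => k _.
by rewrite ler_piMr ?fine_ge0//; case/andP: (p01 k).
Qed.

Lemma integral_degree (n : nat) (g : nat -> R) : (0 < n)%N ->
  (forall k, 0 <= g k) ->
  (\int[nu_ n]_k (g k)%:E)%E = (\sum_(k < n) fine (nu_ n [set val k]) * g k)%:E.
Proof.
move=> n0 g0.
have H m : (\int[nu_ n]_(k in [set k | (k < m)%N]) (g k)%:E)%E =
    (\sum_(k < m) fine (nu_ n [set val k]) * g k)%:E.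
  elim: m => [|m IH].
    rewrite big_ord0 (_ : mkset _ = set0) ?integral_set0//.
    by apply/seteqP; split.
  rewrite (_ : mkset _ = [set k | (k < m)%N] `|` [set m]); last first.
    apply/seteqP; split => k /=; last by case => [/ltnW//|->].
    by rewrite ltnS leq_eqVlt => /orP[/eqP|]; [right|left].
  rewrite ge0_integral_setU//=; last 2 first.
  - by move=> k _; rewrite lee_fin.
  - by apply/disj_setPS => k [/= km kE]; rewrite kE ltnn in km.
  rewrite big_ord_recr EFinD IH; congr (_ + _)%E.
  rewrite (eq_integral (cst (g m)%:E)); last by move=> k; rewrite inE => ->.
  by rewrite integral_cst// EFinM fineK ?fin_num_measure// muleC.
have nuC : nu_ n (~` [set k | (k < n)%N]) = 0%E.
  by rewrite probability_setC// nu_supp// subee.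
rewrite -H -[setT](setUv [set k | (k < n)%N]) ge0_integral_setU//=;
  last 2 first.
- by move=> k _; rewrite lee_fin.
- by apply/disj_setPCl.
by rewrite [X in (_ + X)%E]null_set_integral ?adde0.
Qed.

Context (nu : probability R R).
Hypothesis nu_cvg : cvg_in_distribution
  (fun n : nat => distribution (nu_ n) (degree_ratio R n)) nu.

(** What [attach] would be if choices were made with replacement: a moment of
    the law of D / (m + 1), to which the convergence in distribution applies. *)
Definition ratio_moment (m c : nat) : R :=
  \sum_(k < m.+1) fine (nu_ m.+1 [set val k]) * (k%:R / m.+1%:R) ^+ c.

Lemma cvg_ratio_moment c : ratio_moment m c @[m --> \oo] --> moment nu c.
Proof.
have bnd : exists M : R, forall x, `|clamp x ^+ c| <= M.
  by exists 1 => x; have /andP[h0 h1] := clampX01 c x; rewrite ger0_norm.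
have := nu_cvg (continuous_clampX (c := c)) bnd.
rewrite momentE -(cvg_shiftn 1)/= => /fine_cvg; apply: cvg_trans.
apply: near_eq_cvg; near=> m => /=.
rewrite addn1 ge0_integral_distribution//; last 2 first.
- by apply/measurable_EFinP; exact: measurable_clampX.
- by move=> x; rewrite lee_fin; case/andP: (clampX01 c x).
rewrite (integral_degree (g := fun k => clamp (degree_ratio R m.+1 k) ^+ c))//;
  last first.
  by move=> k; case/andP: (clampX01 c (degree_ratio R m.+1 k)).
apply: eq_bigr => k _; rewrite /degree_ratio clampE// divr_ge0//=.
by rewrite ler_pdivrMr// mul1r ler_nat ltnW.
Unshelve. all: by end_near. Qed.

(** Given the degree [k], both sides are products of [c] factors, one for each
    draw, and [ratio_dist] compares them factor by factor. *)
Lemma attach_dist m c : (c <= m)%N ->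
  `|attach m c - ratio_moment m c| <= (c ^ 2)%:R / (m - c).+1%:R.
Proof.
move=> cm; rewrite attachE /ratio_moment -sumrB.
apply: (@le_trans _ _ (\sum_(k < m.+1) fine (nu_ m.+1 [set val k]) *
  ((c ^ 2)%:R / (m - c).+1%:R))); last by rewrite -mulr_suml nu_sum1 mul1r.
apply: (le_trans (ler_norm_sum _ _ _)); apply: ler_sum => k _.
rewrite -mulrBr normrM ger0_norm ?fine_ge0// ler_wpM2l ?fine_ge0//.
have -> : (k%:R / m.+1%:R) ^+ c = \prod_(l < c) (k%:R / m.+1%:R) :> R.
  by rewrite prodr_const card_ord.
apply: (le_trans (ler_dist_prod _ _ _)).
- by move=> l; rewrite ratio01// -ltnS.
- by move=> l; rewrite divr_ge0//= ler_pdivrMr// mul1r ler_nat ltnW.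
apply: (@le_trans _ _ (\sum_(l < c) (c%:R / (m - c).+1%:R))); last first.
  by rewrite sumr_const card_ord -[(_ / _) *+ _]mulr_natl mulrA -natrM mulnn.
apply: ler_sum => l _; apply: (le_trans (ratio_dist _ _)).
- exact: leq_trans cm.
- by rewrite -ltnS.
rewrite ler_pM ?invr_ge0// ?ler_nat//.
rewrite lef_pV2 ?posrE ?ltr0n ?subn_gt0 ?(leq_trans _ cm)//.
by rewrite ler_nat; have := ltn_ord l; lia.
Qed.

Lemma cvg_attach c : attach m c @[m --> \oo] --> moment nu c.
Proof.
rewrite -[moment nu c]add0r.
have -> : attach^~ c =
    (fun m => (attach m c - ratio_moment m c) + ratio_moment m c).
  by apply/funext => m; rewrite subrK.
apply: cvgD; last exact: cvg_ratio_moment.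
(* Shifting by [c] turns the bound of [attach_dist] into a harmonic one. *)
apply/norm_cvg0P; rewrite -(cvg_shiftn c)/=.
apply: (@squeeze_cvgr _ _ _ _ (fun _ => 0) (fun m => (c ^ 2)%:R * harmonic m)).
- near=> m; rewrite normr_ge0/= (le_trans (attach_dist _)) ?leq_addl//.
  by rewrite addnK.
- exact: cvg_cst.
- rewrite -[X in _ --> X](mulr0 (c ^ 2)%:R).
  by apply: cvgM; [exact: cvg_cst|exact: cvg_harmonic].
Unshelve. all: by end_near. Qed.

End GrowingSteps.

Arguments law {R d T} P N n g.

(** * The densities of the limit *)

(** Fubini: a product of functions of independent coordinates integrates to the
    product of the integrals. *)
Lemma integral_prob_power_prod d (S : measurableType d) (R : realType)
    (mu : probability S R) k (f : 'I_k -> S -> R) (m : 'I_k -> R) :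
  (forall i, measurable_fun setT (f i)) -> (forall i x, 0 <= f i x) ->
  (forall i, (\int[mu]_x (f i x)%:E = (m i)%:E)%E) ->
  (\int[prob_power mu k]_x (\prod_i f i (tnth x i))%:E = (\prod_i m i)%:E)%E.
Proof.
elim: k f m => [|k IH] f m mf f0 fm.
  rewrite (eq_integral (cst 1%E)) => [|x _]; last by rewrite big_ord0.
  by rewrite integral_cst//= big_ord0 diracT mul1e.
have mprod (j : nat) (h : 'I_j -> S -> R) :
    (forall i, measurable_fun setT (h i)) ->
    measurable_fun setT (fun x : j.-tuple S => \prod_i h i (tnth x i)).
  move=> mh; apply: measurable_prod => i _.
  exact: measurableT_comp (mh i) (measurable_tnth i).
rewrite /= ge0_integral_distribution//; last 2 first.
- by apply/measurable_EFinP; exact: mprod.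
- by move=> x; rewrite lee_fin prodr_ge0.
rewrite fubini_tonelli1//=; last 2 first.
- apply: measurableT_comp; last exact: measurable_funPT.
  by apply/measurable_EFinP; exact: mprod.
- by move=> x; rewrite lee_fin prodr_ge0.
have inner x : fubini_F (prob_power mu k)
    (EFin \o (fun y : k.+1.-tuple S => \prod_i f i (tnth y i))
      \o cons_pair k) x =
    ((f ord0 x)%:E * (\prod_i m (lift ord0 i))%:E)%E.
  rewrite /fubini_F -(IH (fun i => f (lift ord0 i))); last 3 first.
  - by move=> i; exact: mf.
  - by move=> i y; exact: f0.
  - by move=> i; exact: fm.
  rewrite -ge0_integralZl ?lee_fin//; last 2 first.
  - by apply/measurable_EFinP; exact: (mprod _ (fun i => f (lift ord0 i))).
  - by move=> y _; rewrite lee_fin prodr_ge0.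
  apply: eq_integral => y _; rewrite /= -EFinM big_ord_recl; congr (_ * _)%:E.
  by apply: eq_bigr => i _; rewrite tnthS.
rewrite (eq_integral _ _ (fun x _ => inner x)) ge0_integralZr//=.
- by rewrite fm -EFinM big_ord_recl.
- exact/measurable_EFinP.
- by move=> x _; rewrite lee_fin.
- rewrite lee_fin prodr_ge0// => i _; rewrite -lee_fin -fm.
  by apply: integral_ge0 => x _; rewrite lee_fin.
Qed.

Section Cells.
Context (R : realType).

Definition cell (n a : nat) : set R := `[a%:R / n%:R, a.+1%:R / n%:R[%classic.

Lemma measurable_cell n a : measurable (cell n a).
Proof. exact: measurable_itv. Qed.

Lemma uniform_cell n (a : 'I_n) :
  (\int[uniform_prob (@ltr01 R)]_t (\1_(cell n a) t)%:E = (n%:R^-1)%:E)%E.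
Proof.
have n0 : 0 < n%:R :> R by rewrite ltr0n (leq_ltn_trans _ (ltn_ord a)).
rewrite integral_uniform//; last first.
  apply/measurable_EFinP; exact: measurable_indic (measurable_cell n a).
rewrite subr0 invr1 mul1e integral_indic//; last exact: measurable_cell.
rewrite setIidl; last first.
  move=> t; rewrite /cell /= !in_itv/= => /andP[h1 h2]; apply/andP; split.
    by apply: le_trans h1; rewrite divr_ge0.
  by rewrite (le_trans (ltW h2))// ler_pdivrMr// mul1r ler_nat.
rewrite /cell /= lebesgue_measure_itv/= lte_fin ltr_pM2r ?invr_gt0//.
rewrite ltr_nat ltnSn.
by rewrite -EFinD -mulrBl -natr1 addrAC subrr add0r mul1r.
Qed.

Lemma sum_cell n (t : R) : (0 < n)%N ->
  \sum_(a < n) \1_(cell n a) t = \1_(`[0, 1[%classic : set R) t :> R.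
Proof.
move=> n0; have n0R : 0 < n%:R :> R by rewrite ltr0n.
have cellE a : (t \in cell n a) = (a%:R <= t * n%:R < a.+1%:R).
  by rewrite /cell mem_setE in_itv/= ler_pdivrMr// ltr_pdivlMr.
rewrite indicE mem_setE in_itv/=.
case: (boolP (0 <= t < 1)) => /= [/andP[t0 t1]|t01].
  have tn0 : 0 <= t * n%:R by rewrite mulr_ge0// ltW.
  have /andP[h1 h2] := truncn_itv tn0.
  have an : (Num.truncn (t * n%:R) < n)%N.
    by rewrite -(ltr_nat R) (le_lt_trans h1)// gtr_pMl.
  rewrite (bigD1 (Ordinal an))//= indicE cellE h1 h2 /= big1 ?addr0// => a aE.
  rewrite indicE cellE; case: (boolP (_ <= _ < _)) => // /andP[h3 h4].
  case/negP: aE; apply/eqP/val_inj => /=; apply/anti_leq.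
  by apply/andP; split; rewrite -ltnS -(ltr_nat R);
    [exact: le_lt_trans h2|exact: le_lt_trans h4].
rewrite big1// => a _; rewrite indicE cellE; case: (boolP (_ <= _ < _)) => //.
move=> /andP[h1 h2]; case/negP: t01; apply/andP; split.
  by rewrite -(pmulr_lge0 _ n0R) (le_trans _ h1).
by rewrite -(ltr_pM2r n0R) mul1r (lt_le_trans h2)// ler_nat.
Qed.

Lemma cell_lt n a b (t u : R) : (a < b)%N ->
  t \in cell n a -> u \in cell n b -> t < u.
Proof.
move=> ab; rewrite /cell !mem_setE !in_itv/= => /andP[_ ta] /andP[ub _].
by rewrite (lt_le_trans ta)// (le_trans _ ub)// ler_wpM2r ?invr_ge0// ler_nat.
Qed.

End Cells.

(** Counting edges at their younger end: the mark of [v] occurs once for each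
    neighbour of [v] with an older image. *)
Lemma prod_younger_end (R : comPzSemiRingType) k n (F : sgraph k)
    (phi : {ffun 'I_k -> 'I_n}) (s : 'I_k -> R) : injective phi ->
  \prod_(i < k) \prod_(j < k | (i < j)%N && adj F i j)
    (if (phi i < phi j)%N then s j else s i) =
  \prod_v s v ^+ older_degree F phi v.
Proof.
move=> phiI.
have degE v : s v ^+ older_degree F phi v =
    \prod_(u | adj F u v && (phi u < phi v)%N) s v.
  by rewrite /older_degree -prodr_const; apply: eq_bigl => u; rewrite inE.
rewrite (eq_bigr _ (fun v _ => degE v)) {degE}.
transitivity (\prod_(i < k)
    (\prod_(j < k | [&& (i < j)%N, adj F i j & (phi i < phi j)%N]) s j *
     \prod_(j < k | [&& (i < j)%N, adj F i j & (phi j < phi i)%N]) s i)).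
  apply: eq_bigr => i _; rewrite (bigID (fun j => (phi i < phi j)%N))/=.
  congr (_ * _); apply: eq_big => j.
  - by rewrite andbA.
  - by move=> /andP[_ ->].
  - rewrite -andbA; congr (_ && _); case: (boolP (adj F i j)) => //= Fij.
    rewrite -leqNgt [LHS]leq_eqVlt.
    have [/val_inj/phiI ij|//] := eqVneq (val (phi j)) (phi i).
    by rewrite ij adjxx in Fij.
  - by case/andP => _ /negbTE ->.
rewrite big_split /=.
transitivity (\prod_(v < k)
    (\prod_(u < k | [&& (u < v)%N, adj F u v & (phi u < phi v)%N]) s v *
     \prod_(u < k | [&& (v < u)%N, adj F u v & (phi u < phi v)%N]) s v)).
  rewrite big_split; congr (_ * _) => /=.
    by rewrite (exchange_big_dep xpredT).
  by apply: eq_bigr => v _; apply: eq_bigl => u; rewrite adjC.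
apply: eq_bigr => v _; rewrite [RHS](bigID (fun u : 'I_k => (u < v)%N))/=.
congr (_ * _); apply: eq_bigl => u; first by rewrite andbC.
rewrite andbC -leqNgt; case: (boolP (adj F u v)) => //= Fuv.
rewrite [(v <= u)%N]leq_eqVlt; have [/val_inj uv|//] := eqVneq (val v) u.
by rewrite uv adjxx in Fuv.
Qed.

Section LimitDensity.
Context (R : realType) (nu : probability R R).
Hypothesis nu01 : nu `[0, 1]%classic = 1%E.

Let S := (R * measurableTypeR R)%type.
Let mu : probability S R := mu_nu nu.

(** Forcing the marks into [0, 1] makes all products of values of the kernel
    bounded; it only matters on a null set. *)
Definition W_clamp (x y : R * R) : R :=
  if x.2 < y.2 then clamp y.1 else if y.2 < x.2 then clamp x.1 else 0.

Definition edge_prod (W : R * R -> R * R -> R) k (F : sgraph k)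
    (x : k.-tuple (R * R)) : R :=
  \prod_(i < k) \prod_(j < k | (i < j)%N && adj F i j) W (tnth x i) (tnth x j).

Lemma integral_mu_prod (f g : R -> R) (a b : R) :
  measurable_fun setT f -> measurable_fun setT g ->
  (forall x, 0 <= f x) -> (forall x, 0 <= g x) ->
  (\int[nu]_x (f x)%:E = a%:E)%E ->
  (\int[uniform_prob (@ltr01 R)]_x (g x)%:E = b%:E)%E ->
  (\int[mu]_x (f x.1 * g x.2)%:E = (a * b)%:E)%E.
Proof.
move=> mf mg f0 g0 fa gb; rewrite /mu /mu_nu fubini_tonelli1/=; last 2 first.
- apply/measurable_EFinP; apply: measurable_funM.
  + exact: measurableT_comp mf measurable_fst.
  + exact: measurableT_comp mg measurable_snd.
- by move=> x; rewrite lee_fin mulr_ge0.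
have b0 : 0 <= b by rewrite -lee_fin -gb integral_ge0// => x _; rewrite lee_fin.
rewrite (eq_integral (fun x => (f x)%:E * b%:E)%E); last first.
  move=> x _; rewrite /fubini_F -gb -ge0_integralZl ?lee_fin//.
    by apply/measurable_EFinP.
  by move=> y _; rewrite lee_fin.
rewrite ge0_integralZr ?lee_fin//.
- by rewrite fa EFinM.
- exact/measurable_EFinP.
- by move=> x _; rewrite lee_fin.
Qed.

Lemma measurable_W_nu :
  measurable_fun setT (fun p : S * S => W_nu p.1 p.2).
Proof.
have m21 : measurable_fun setT (fun p : S * S => p.1.2 : R).
  exact: measurableT_comp measurable_snd measurable_fst.
have m22 : measurable_fun setT (fun p : S * S => p.2.2 : R).
  exact: measurableT_comp measurable_snd measurable_snd.
rewrite /W_nu; apply: measurable_fun_ifT; first exact: measurable_fun_ltr.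
  exact: measurableT_comp measurable_fst measurable_snd.
apply: measurable_fun_ifT; first exact: measurable_fun_ltr.
  exact: measurableT_comp measurable_fst measurable_fst.
exact: measurable_cst.
Qed.

Lemma measurable_W_clamp :
  measurable_fun setT (fun p : S * S => W_clamp p.1 p.2).
Proof.
have mclamp : measurable_fun setT (@clamp R) := measurable_clampX 1.
have m21 : measurable_fun setT (fun p : S * S => p.1.2 : R).
  exact: measurableT_comp measurable_snd measurable_fst.
have m22 : measurable_fun setT (fun p : S * S => p.2.2 : R).
  exact: measurableT_comp measurable_snd measurable_snd.
rewrite /W_clamp; apply: measurable_fun_ifT; first exact: measurable_fun_ltr.
  apply: measurableT_comp mclamp _.
  exact: measurableT_comp measurable_fst measurable_snd.
apply: measurable_fun_ifT; first exact: measurable_fun_ltr.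
  apply: measurableT_comp mclamp _.
  exact: measurableT_comp measurable_fst measurable_fst.
exact: measurable_cst.
Qed.

Lemma measurable_edge_prod (W : R * R -> R * R -> R) k (F : sgraph k) :
  measurable_fun setT (fun p : S * S => W p.1 p.2) ->
  measurable_fun setT (fun x : k.-tuple S => edge_prod W F x).
Proof.
move=> mW; rewrite /edge_prod; apply: measurable_prod => i _.
under eq_fun do rewrite big_mkcond.
apply: measurable_prod => j _; case: (_ && _); last exact: measurable_cst.
apply: (measurableT_comp (f := fun p : S * S => W p.1 p.2)
  (g := fun x : k.-tuple S => (tnth x i, tnth x j))) => //.
by apply: measurable_fun_pair; exact: measurable_tnth.
Qed.

Lemma W_clamp01 x y : 0 <= W_clamp x y <= 1.
Proof.
by rewrite /W_clamp; do 2?case: ifP => _; rewrite ?clamp01 ?lexx ?ler01.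
Qed.

Lemma edge_prod01 k (F : sgraph k) x : 0 <= edge_prod W_clamp F x <= 1.
Proof.
have W01 i j := W_clamp01 (tnth x i) (tnth x j).
have H (i : 'I_k) : 0 <= \prod_(j < k | (i < j)%N && adj F i j)
    W_clamp (tnth x i) (tnth x j) <= 1.
  by rewrite prodr_ge0 ?prodr_ile1// => j _; case/andP: (W01 i j).
by rewrite /edge_prod prodr_ge0 ?prodr_ile1// => i _; case/andP: (H i).
Qed.

Definition timely k (x : k.-tuple S) : R :=
  \prod_i \1_(`[0, 1[%classic : set R) (tnth x i).2.

(** Almost surely all marks lie in [0, 1] and all times in [0, 1), the union of
    the cells. *)
Lemma kernel_density_clamp k (F : sgraph k) :
  (kernel_density mu (@W_nu R) F)%:E =
  (\int[prob_power mu k]_x (timely x * edge_prod W_clamp F x)%:E)%E.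
Proof.
pose I1 : set R := `[0, 1]%classic; pose I2 : set R := `[0, 1[%classic.
have mI1 : measurable I1 by exact: measurable_itv.
have mI2 : measurable I2 by exact: measurable_itv.
have m1 : measurable_fun setT (\1_I1 : R -> R) by exact: measurable_indic.
have m2 : measurable_fun setT (\1_I2 : R -> R) by exact: measurable_indic.
have ind0 (A : set R) x : 0 <= (\1_A x : R) by rewrite indicE.
have ind1 (x : S) :
    \1_I1 x.1 * \1_I2 x.2 = ((x.1 \in I1) && (x.2 \in I2))%:R :> R.
  by rewrite !indicE -natrM mulnb.
have mh1 : measurable_fun setT (fun x : S => \1_I1 x.1 * \1_I2 x.2 : R).
  apply: measurable_funM.
  - exact: measurableT_comp m1 measurable_fst.
  - exact: measurableT_comp m2 measurable_snd.
have int1 : (\int[mu]_x (\1_I1 x.1 * \1_I2 x.2)%:E = 1%:E)%E.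
  rewrite -[in RHS](mulr1 1); apply: integral_mu_prod => //.
    by rewrite integral_indic//= setIT.
  by have := uniform_cell R (@ord0 0); rewrite /cell mul0r divr1 invr1.
pose h (x : k.-tuple S) : R :=
  \prod_i (\1_I1 (tnth x i).1 * \1_I2 (tnth x i).2).
have mh : measurable_fun setT h.
  apply: measurable_prod => i _.
  exact: measurableT_comp mh1 (measurable_tnth i).
pose A : set (k.-tuple S) :=
  [set x | forall i, (tnth x i).1 \in I1 /\ (tnth x i).2 \in I2].
have hE : h = \1_A.
  apply/funext => x; rewrite /h indicE; have [|xA] := boolP (x \in A).
    rewrite inE => xA; rewrite big1// => i _; rewrite ind1.
    by have [-> ->] := xA i.
  have [i xi] : exists i, ~ ((tnth x i).1 \in I1 /\ (tnth x i).2 \in I2).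
    by apply/existsNP => xA'; move/negP: xA; apply; rewrite inE.
  rewrite (bigD1 i)//= ind1 (_ : _ && _ = false) ?mul0r//.
  by apply/negbTE/negP => /andP.
have mA : measurable A.
  rewrite (_ : A = setT `&` h @^-1` [set 1]); first exact: mh.
  rewrite setTI hE; apply/seteqP; split => x /=; rewrite indicE.
    by move=> /mem_set ->.
  by case: (boolP (x \in A)) => [/set_mem//|_ /eqP]; rewrite eq_sym oner_eq0.
have PA : prob_power mu k A = 1%E.
  transitivity (\int[prob_power mu k]_x (h x)%:E)%E.
    by rewrite hE integral_indic//= setIT.
  rewrite (integral_prob_power_prod (m := fun=> 1) (fun=> mh1))//.
  by rewrite big1.
have PAC : prob_power mu k (~` A) = 0%E.
  by rewrite probability_setC// PA subee.
have mW : measurable_fun setT (fun x : k.-tuple S => edge_prod (@W_nu R) F x).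
  by apply: measurable_edge_prod; exact: measurable_W_nu.
have m22 : measurable_fun setT (fun x : S => \1_I2 x.2 : R).
  exact: measurableT_comp m2 measurable_snd.
have mT : measurable_fun setT
    (fun x : k.-tuple S => timely x * edge_prod W_clamp F x).
  apply: measurable_funM.
    apply: measurable_prod => i _.
    exact: measurableT_comp m22 (measurable_tnth i).
  by apply: measurable_edge_prod; exact: measurable_W_clamp.
have T01 x : 0 <= timely x * edge_prod W_clamp F x <= 1.
  have /andP[e0 e1] := edge_prod01 F x.
  have t01 : 0 <= timely x <= 1.
    rewrite /timely prodr_ge0 ?prodr_ile1// => i _.
      by rewrite ind0 indicE; case: (_ \in _) => //=; rewrite ler01.
  by case/andP: t01 => t0 t1; rewrite mulr_ge0 ?mulr_ile1.
rewrite /kernel_density /Rintegral.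
rewrite (ae_eq_integral (fun x : k.-tuple S =>
  (timely x * edge_prod W_clamp F x)%:E))//; last first.
- exists (~` A); split => [||x /= /not_implyP[_ neq] xA].
  + exact: measurableC.
  + exact: PAC.
  have tx1 : timely x = 1.
    by rewrite /timely big1// => i _; rewrite indicE; have [_ ->] := xA i.
  apply: neq; congr EFin; rewrite tx1 mul1r.
  apply: eq_bigr => i _; apply: eq_bigr => j _.
  have clE l : clamp (tnth x l).1 = (tnth x l).1.
    have [+ _] := xA l; rewrite mem_setE in_itv/=; exact: clampE.
  by rewrite /W_clamp !clE.
- exact/measurable_EFinP.
- exact/measurable_EFinP.
have /andP[i0 i1] := integral_itv01 (prob_power mu k) mT T01.
by rewrite fineK// ge0_fin_numE// (le_lt_trans i1)// ltry.
Qed.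

Lemma integral_marked_cell n (a : 'I_n) c :
  (\int[mu]_x (clamp x.1 ^+ c * \1_(cell n a) x.2)%:E =
   (moment nu c / n%:R)%:E)%E.
Proof.
apply: (@integral_mu_prod (fun x => clamp x ^+ c) (\1_(cell n a)) _ _ _ _ _ _
  (momentE nu c) (uniform_cell R a)) => [||x|x].
- exact: measurable_clampX.
- by apply: measurable_indic; exact: measurable_cell.
- by case/andP: (clampX01 c x).
- by rewrite indicE.
Qed.

(** Cutting [0, 1) into [n] cells splits the integral into one part for each
    map [phi] from the vertices of [F] to the cells; [c phi] is this part
    divided by the measure [n ^- k] of its domain.  If [phi] is injective,
    the order of the times is the order of the cells, the kernel selects the
    marks of the younger ends, and the integrand becomes a product of functions
    of the single points. *)
Lemma kernel_density_avg k n (F : sgraph k) : (0 < n)%N ->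
  exists c : {ffun 'I_k -> 'I_n} -> R,
  [/\ kernel_density mu (@W_nu R) F = avg c,
      forall phi, 0 <= c phi <= 1 &
      forall phi : {ffun 'I_k -> 'I_n}, injective phi ->
        c phi = \prod_v moment nu (older_degree F phi v)].
Proof.
move=> n0; have n0R : 0 < n%:R :> R by rewrite ltr0n.
pose ind (phi : {ffun 'I_k -> 'I_n}) (x : k.-tuple S) : R :=
  \prod_i \1_(cell n (phi i)) (tnth x i).2.
have ind0 phi x : 0 <= ind phi x by rewrite prodr_ge0// => i _; rewrite indicE.
have mcell a : measurable_fun setT (fun x : S => \1_(cell n a) x.2 : R).
  apply: measurableT_comp measurable_snd.
  by apply: measurable_indic; exact: measurable_cell.
have mind phi : measurable_fun setT (ind phi).
  apply: measurable_prod => i _.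
  exact: measurableT_comp (mcell _) (measurable_tnth i).
have mE : measurable_fun setT (fun x : k.-tuple S => edge_prod W_clamp F x).
  by apply: measurable_edge_prod; exact: measurable_W_clamp.
have indE phi : (\int[prob_power mu k]_x (ind phi x)%:E = (n%:R ^- k)%:E)%E.
  have -> : n%:R ^- k = \prod_(i < k) n%:R^-1 :> R.
    by rewrite prodr_const card_ord exprVn.
  apply: (integral_prob_power_prod (mu := mu)
    (f := fun i (x : S) => \1_(cell n (phi i)) x.2)) => // i.
  have := integral_marked_cell (phi i) 0.
  rewrite (_ : moment nu 0 = 1); last first.
    apply: EFin_inj; rewrite -momentE.
    rewrite (eq_integral (cst 1%:E)) => [|x _]; last by rewrite expr0.
    by rewrite integral_cst//= mul1e probability_setT.
  rewrite mul1r => <-; apply: eq_integral => x _.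
  by rewrite expr0 mul1r.
pose I phi :=
  (\int[prob_power mu k]_x (ind phi x * edge_prod W_clamp F x)%:E)%E.
have mI phi : measurable_fun setT (fun x => ind phi x * edge_prod W_clamp F x).
  exact: measurable_funM.
have I0 phi x : 0 <= ind phi x * edge_prod W_clamp F x.
  by rewrite mulr_ge0//; case/andP: (edge_prod01 F x).
have Ibnd phi : (0 <= I phi <= (n%:R ^- k)%:E)%E.
  apply/andP; split; first by apply: integral_ge0 => x _; rewrite lee_fin.
  rewrite -(indE phi); apply: ge0_le_integral => //=.
  - by move=> x _; rewrite lee_fin.
  - exact/measurable_EFinP.
  - exact/measurable_EFinP.
  - by move=> x _; rewrite lee_fin ler_piMr//; case/andP: (edge_prod01 F x).
have Ifin phi : (fine (I phi))%:E = I phi.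
  case/andP: (Ibnd phi) => h0 h1.
  by rewrite fineK// ge0_fin_numE// (le_lt_trans h1)// ltry.
have nk0 : 0 < n%:R ^+ k :> R by rewrite exprn_gt0.
exists (fun phi => n%:R ^+ k * fine (I phi)); split => [|phi|phi phiI].
- rewrite avgZ /avg card_ffun !card_ord natrX mulrCA divff ?gt_eqF// mulr1.
  apply: EFin_inj; rewrite kernel_density_clamp -sumEFin.
  rewrite (eq_bigr _ (fun phi _ => Ifin phi)) -ge0_integral_sum//; last 2 first.
  + by move=> phi; apply/measurable_EFinP.
  + by move=> phi x _; rewrite lee_fin.
  apply: eq_integral => x _; rewrite sumEFin; congr EFin; rewrite -mulr_suml.
  congr (_ * _); rewrite /timely /ind.
  rewrite -(bigA_distr_bigA
    (fun i (a : 'I_n) => \1_(cell n a) (tnth x i).2 : R)).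
  apply: eq_bigr => i _.
  by rewrite sum_cell.
- case/andP: (Ibnd phi); rewrite -Ifin !lee_fin => h0 h1.
  by rewrite mulr_ge0 ?(ltW nk0)//= -ler_pdivlMl// mulr1.
apply: (canLR (mulVKf _)); first by rewrite gt_eqF.
apply: EFin_inj; rewrite Ifin.
transitivity ((\prod_v (moment nu (older_degree F phi v) / n%:R))%:E);
  last first.
  by rewrite big_split /= prodr_const card_ord exprVn mulrC.
pose f v (x : S) := clamp x.1 ^+ older_degree F phi v * \1_(cell n (phi v)) x.2.
rewrite -(@integral_prob_power_prod _ _ _ mu _ f).
- apply: eq_integral => x _; congr EFin.
  have [xphi|/existsNP[i xi]] :=
      pselect (forall i, (tnth x i).2 \in cell n (phi i)); last first.
    have indi0 : \1_(cell n (phi i)) (tnth x i).2 = 0 :> R.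
      by rewrite indicE; move/negP/negbTE: xi => ->.
    by rewrite /ind /f (bigD1 i)//= [RHS](bigD1 i)//= indi0 mulr0 !mul0r.
  rewrite /ind big1 ?mul1r => [|i _]; last by rewrite indicE xphi.
  transitivity (\prod_v clamp (tnth x v).1 ^+ older_degree F phi v); last first.
    by apply: eq_bigr => v _; rewrite /f indicE xphi mulr1.
  rewrite -(prod_younger_end F (fun v => clamp (tnth x v).1) phiI).
  apply: eq_bigr => i _; apply: eq_bigr => j /andP[ij _].
  have phi_neq : phi i != phi j :> nat.
    by apply: contraTneq ij => /val_inj/phiI ->; rewrite ltnn.
  rewrite /W_clamp; case: ltnP => [lt_ij|le_ji].
    by rewrite (cell_lt lt_ij (xphi i) (xphi j)).
  have lt_ji : (phi j < phi i)%N by rewrite ltn_neqAle eq_sym phi_neq.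
  have lt_t := cell_lt lt_ji (xphi j) (xphi i).
  by rewrite ltNge (ltW lt_t) /= lt_t.
- move=> v; apply: measurable_funM => //.
  exact: measurableT_comp (measurable_clampX _) measurable_fst.
- move=> v x; rewrite mulr_ge0 ?indicE//.
  by case/andP: (clampX01 (older_degree F phi v) x.1).
- by move=> v; exact: integral_marked_cell.
Qed.

End LimitDensity.

(** * Convergence in probability *)

(** Otherwise there would be points outside the ball whose first [m] coordinates
    are [1 / (m + 1)]-close to those of [l], for every [m]; they converge to [l]
    pointwise, hence for the product topology, and so enter the ball. *)
Lemma ptws_ball_coordinates (R : realType) (U : countType)
    (l : {ptws U -> R}) (e : R) : 0 < e ->
  exists (s : seq U) (r : R), 0 < r /\
    forall x : {ptws U -> R},
      (forall o, o \in s -> `|x o - l o| < r) -> ball l e x.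
Proof.
move=> e0; apply: contrapT => notball.
pose s (m : nat) : seq U := pmap unpickle (iota 0 m).
have /choice[x xP] : forall m, exists y : {ptws U -> R},
    (forall o, o \in s m -> `|y o - l o| < harmonic m) /\ ~ ball l e y.
  move=> m; apply: contrapT => /forallNP noy; apply: notball.
  exists (s m), (harmonic m).
  split=> [|y ys]; first by rewrite invr_gt0.
  by apply: contrapT => nb; apply: (noy y).
have cvg_coord o : x m o @[m --> \oo] --> l o.
  apply/cvgrPdist_lt => r r0; near=> m.
  rewrite distrC (@lt_trans _ _ (harmonic m))//.
    apply: (xP m).1; rewrite mem_pmap; apply/mapP; exists (pickle o).
      rewrite mem_iota add0n; near: m; exact: nbhs_infty_gt.
    by rewrite pickleK.
  near: m; have /cvgrPdist_lt/(_ r r0) := @cvg_harmonic R.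
  by apply: filterS => m; rewrite sub0r normrN ger0_norm ?invr_ge0.
have : x m @[m --> \oo] --> l.
  apply/cvg_sup => o; apply/cvg_image.
    by rewrite eqEsubset; split=> v // _; exists (cst v).
  move=> A /(cvg_coord o) Ax; exists (@^~ o @^-1` A) => //.
  by rewrite eqEsubset; split => [y [z + <-//]|y Ay]; exists (fun=> y).
move=> /(_ _ (nbhsx_ballx l e e0)) [m _ /(_ m (leqnn m))].
exact: (xP m).2.
Unshelve. all: by end_near. Qed.

Lemma cvg_inv_nat (R : realType) (C : R) : C / n%:R @[n --> \oo] --> 0.
Proof.
have : C * harmonic n @[n --> \oo] --> C * 0.
  by apply: cvgM; [exact: cvg_cst|exact: cvg_harmonic].
rewrite mulr0 -[X in _ -> X](cvg_shiftn 1); apply: cvg_trans.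
by apply: near_eq_cvg; near=> n; rewrite /= addn1.
Unshelve. all: by end_near.
Qed.

Lemma cvg_sum0 (R : realType) (I : Type) (s : seq I) (f : I -> nat -> R) :
  (forall i, f i n @[n --> \oo] --> 0) ->
  \sum_(i <- s) f i n @[n --> \oo] --> 0.
Proof.
move=> f0.
rewrite -[X in _ --> X](_ : \sum_(i <- s) (0 : R) = 0); last exact: big1.
by apply: cvg_big => //; exact: add_continuous.
Qed.

Section Convergence.
Context (R : realType) (d : measure_display) (T : measurableType d).
Context (P : probability T R) (nu_ : nat -> probability nat R).
Context (D : nat -> T -> nat) (N : forall n : nat, T -> {set 'I_n.-1}).
Context (nu : probability R R).
Hypothesis nu_supp :
  forall n : nat, (1 <= n)%N -> nu_ n [set k : nat | (k < n)%N] = 1%E.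
Hypothesis steps : growing_steps P nu_ D N.
Hypothesis nu01 : nu `[0, 1]%classic = 1%E.
Hypothesis nu_cvg : cvg_in_distribution
  (fun n : nat => distribution (nu_ n) (degree_ratio R n)) nu.

Let p_ge0 n (g : sgraph n) : 0 <= law P N n g. Proof. exact: law_ge0. Qed.
Let p_sum1 n : \sum_g law P N n g = 1. Proof. exact: (law_sum1 steps). Qed.

(** Overlapping pairs of maps contribute at most [1] each, others nothing. *)
Lemma avg_covariance k n (F : sgraph k) : (0 < n)%N ->
  avg (fun phi : {ffun 'I_k -> 'I_n} => avg (fun psi =>
    prob (law P N n) (fun g => is_hom F phi g && is_hom F psi g)
    - prob (law P N n) (is_hom F phi) * prob (law P N n) (is_hom F psi)))
  <= (k ^ 2)%:R / n%:R.
Proof.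
move=> n0; apply: le_trans (avg_overlap k n0).
apply: ler_avg => phi; apply: ler_avg => psi.
have [ex|disj] := boolP [exists i, exists j, phi i == psi j]; last first.
  have -> : prob (law P N n) (fun g => is_hom F phi g && is_hom F psi g) =
    prob (law P N n) (is_hom F phi) * prob (law P N n) (is_hom F psi).
    exact: (prob_both_hom_disjoint nu_supp steps).
  by rewrite subrr.
rewrite lerBlDr (le_trans (prob_le1 _ _ _))//.
by rewrite lerDl mulr_ge0// prob_ge0.
Qed.

(** The first term accounts for the maps that are not injective, the second for
    replacing the attachment probabilities by their limits. *)
Definition mean_error k n : R := (k ^ 2)%:R / n%:R +
  \sum_(i < k) \sum_(c < k.+1)
    avg (fun a : 'I_n => `|attach nu_ a c - moment nu c|).

Lemma dist_mean_density k n (F : sgraph k) : (0 < n)%N ->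
  `|avg (fun phi : {ffun 'I_k -> 'I_n} => prob (law P N n) (is_hom F phi))
    - kernel_density (mu_nu nu) (@W_nu R) F| <= mean_error k n.
Proof.
move=> n0; have [c [-> c01 cE]] := kernel_density_avg nu01 F n0.
rewrite -avgN -avgD (le_trans (ler_norm_avg _))//.
pose err (a : 'I_n) := fun c : 'I_k.+1 => `|attach nu_ a c - moment nu c|.
apply: (@le_trans _ _ (avg (fun phi : {ffun 'I_k -> 'I_n} =>
    (~~ injectiveb phi)%:R + \sum_(i < k) \sum_(c < k.+1) err (phi i) c))).
  apply: ler_avg => phi.
  have err0 i j : 0 <= err i j by exact: normr_ge0.
  have [/injectiveP phiI|_] := boolP (injectiveb phi); last first.
    apply: (@le_trans _ _ 1); last first.
      by rewrite lerDl sumr_ge0// => i _; rewrite sumr_ge0.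
    have p0 := prob_ge0 (is_hom F phi) (@p_ge0 n).
    have p1 := prob_le1 (is_hom F phi) (@p_ge0 n) (p_sum1 n).
    have /andP[h0 h1] := c01 phi.
    by rewrite ler_norml; apply/andP; split; lra.
  rewrite add0r (prob_injective_hom nu_supp steps)// cE//.
  apply: (le_trans (ler_dist_prod _ _ _)) => [i|i|].
  - exact: attach01 nu_supp steps _ _.
  - exact: moment01.
  apply: ler_sum => i _.
  have dk : (older_degree F phi i < k.+1)%N.
    by rewrite ltnS -[X in (_ <= X)%N]card_ord max_card.
  by rewrite (bigD1 (Ordinal dk))//= lerDl sumr_ge0.
rewrite avgD lerD ?avg_not_injective// avg_sum ler_sum// => i _.
rewrite avg_sum ler_sum// => j _.
by rewrite (avg_coord i (fun a => err a j)) ?card_ord.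
Qed.

Lemma cvg_mean_error k : mean_error k n @[n --> \oo] --> 0.
Proof.
rewrite -[X in _ --> X]addr0; apply: cvgD; first exact: cvg_inv_nat.
apply: cvg_sum0 => i; apply: cvg_sum0 => c.
rewrite -(cvg_shiftn 1)/=.
have err0 : `|attach nu_ a c - moment nu c| @[a --> \oo] --> 0.
  apply/norm_cvg0P/subr_cvg0; exact: (cvg_attach nu_supp steps nu_cvg).
have := cesaro err0; rewrite /arithmetic_mean.
apply: cvg_trans; apply: near_eq_cvg; near=> m.
rewrite /= /avg /series /= addn1 card_ord mulrC big_mkord.
by [].
Unshelve. all: by end_near. Qed.

Lemma cvg_prob_density k (F : sgraph k) (r : R) : 0 < r ->
  prob (law P N n) [pred g |
    r <= `|hom_density R F g - kernel_density (mu_nu nu) (@W_nu R) F|]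
  @[n --> \oo] --> 0.
Proof.
move=> r0.
apply: (@squeeze_cvgr _ _ _ _ (fun=> 0) (fun n =>
  ((k ^ 2)%:R / n%:R + mean_error k n ^+ 2) / r ^+ 2)).
- near=> n; have n0 : (0 < n)%N by near: n; exact: nbhs_infty_gt.
  rewrite prob_ge0//=.
  have := chebyshev_avg (@p_ge0 n) (p_sum1 n) r0 (dist_mean_density F n0)
    (avg_covariance F n0).
  apply: le_trans; rewrite le_eqVlt; apply/orP; left; apply/eqP.
  by apply: eq_bigl => g; rewrite /= hom_density_avg.
- exact: cvg_cst.
- rewrite -[X in _ --> X](mul0r (r ^+ 2)^-1); apply: cvgM; last exact: cvg_cst.
  rewrite -[X in _ --> X]addr0; apply: cvgD; first exact: cvg_inv_nat.
  rewrite -[X in _ --> X](mulr0 0); under eq_fun do rewrite expr2.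
  by apply: cvgM; exact: cvg_mean_error.
Unshelve. all: by end_near. Qed.

Lemma cvg_prob_coordinate (o : option finite_graph) (r : R) : 0 < r ->
  prob (law P N n) [pred g | r <= `|graph_point R g o - Gamma_nu nu o|]
  @[n --> \oo] --> 0.
Proof.
move=> r0; case: o => [[k F]|]; first exact: cvg_prob_density.
have /cvgrPdist_lt/(_ r r0) n_large := cvg_inv_nat (1 : R).
apply: cvg_near_cst; apply: filterS n_large => n.
rewrite sub0r normrN div1r => n_large; rewrite /prob big_pred0// => g /=.
by rewrite subr0 leNgt n_large.
Qed.

End Convergence.

Theorem theorem5p5 (R : realType) (d : measure_display) (T : measurableType d)
    (P : probability T R)
    (nu_ : nat -> probability nat R)
    (D : nat -> T -> nat) (N : forall n : nat, T -> {set 'I_n.-1})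
    (nu : probability R R) :
  (forall n : nat, (1 <= n)%N -> nu_ n [set k : nat | (k < n)%N] = 1%E) ->
  growing_steps P nu_ D N ->
  nu `[0, 1]%classic = 1%E ->
  cvg_in_distribution (fun n : nat => distribution (nu_ n) (degree_ratio R n)) nu ->
  cvg_in_probability P
    (fun (n : nat) (w : T) =>
       graph_point R (growth (fun m : nat => N m w) n))
    (Gamma_nu nu).
Proof.
move=> nu_supp steps nu01 nu_cvg e e0.
have [s [r [r0 sP]]] := ptws_ball_coordinates (Gamma_nu nu) e0.
pose far o n := [pred g : sgraph n | r <= `|graph_point R g o - Gamma_nu nu o|].
apply: (@squeeze_cvge _ _ _ _ (fun=> 0%E) _
  (fun n => (\sum_(o <- s) prob (law P N n) (far o n))%:E)).
- apply: nearW => n; rewrite measure_ge0/=.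
  rewrite (_ : mkset _ = [set w | `[< ~ ball (Gamma_nu nu) e
    (graph_point R (growth (fun m => N m w) n)) >]]); last first.
    by apply/seteqP; split => w /= /asboolP.
  rewrite (lawE steps (fun g =>
    `[< ~ ball (Gamma_nu nu) e (graph_point R g) >])) lee_fin.
  apply: le_trans (prob_has _ _ _); last by move=> g; exact: law_ge0.
  apply: ler_prob => [g|g /asboolP nb]; first exact: law_ge0.
  apply/hasP; apply: contrapT => near_g; apply/nb/sP => o os.
  by rewrite ltNge; apply/negP => far_o; apply: near_g; exists o.
- exact: cvg_cst.
- apply: cvg_EFin; first exact: nearW.
  apply: (@cvg_sum0 _ _ s (fun o n => prob (law P N n) (far o n))) => o.
  exact: (cvg_prob_coordinate nu_supp steps nu01 nu_cvg o r0).
Qed.
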